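(* Let $\Sigma$ be a compact Riemann surface of genus $h\ge1$ with Riemann period matrix $\Omega$. Then the following are equivalent: (i) there exist integer vectors $n,m,n',m'\in\mathbb{Z}^h$ with $(n,m)\neq(0,0)$ and a number $c\in\mathbb{C}\setminus\mathbb{Q}$ such that $$m_j'-\sum_{k=1}^h\Omega_{jk}n_k'=\overline{c}\Big(m_j-\sum_{k=1}^h\Omega_{jk}n_k\Big),\qquad j=1,\dots,h;$$ (ii) $\Sigma$ is a branched covering of a torus, i.e. there exists a nonconstant holomorphic map from $\Sigma$ to a complex torus $\mathbb{C}/(\mathbb{Z}+\tau\mathbb{Z})$ with $\operatorname{Im}\tau>0$.
   Context: Let $\alpha_1,\dots,\alpha_h,\beta_1,\dots,\beta_h$ be a symplectic basis of $H_1(\Sigma,\mathbb{Z})$. Let $\omega_1,\dots,\omega_h$ be the basis of holomorphic one-differentials on $\Sigma$ normalized by $\oint_{\alpha_j}\omega_k=\delta_{jk}$. The Riemann period matrix is $\Omega_{jk}=\oint_{\beta_j}\omega_k$; it is symmetric with positive definite imaginary part. Surfaces satisfying (i) are called Special Riemann surfaces. *)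

(* Defs.v *)
From HB Require Import structures.
From mathcomp Require Import all_boot all_order all_algebra.
From mathcomp Require Import all_classical all_reals all_analysis.
From mathcomp Require Import complex.
From mathcomp.multinomials Require Import freeg.

Set Implicit Arguments.
Unset Strict Implicit.
Unset Printing Implicit Defensive.

Import Order.TTheory GRing.Theory Num.Theory numFieldNormedType.Exports.

Local Open Scope classical_set_scope.
Local Open Scope ring_scope.

(* The complex numbers as a bundled [numClosedFieldType], so that the topology
   and the normed structure (over itself) of a numeric field apply to them:
   [derivable f z 1] and [derive1 f z] are complex differentiability and the
   complex derivative. *)
Definition Cplx (R : realType) : numClosedFieldType := R[i].

Definition holomorphic_on (R : realType) (U : set (Cplx R))
    (f : Cplx R -> Cplx R) : Prop :=
  forall z, U z -> derivable f z 1.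

(* [icoord] is the inverse of the homeomorphism
   [coord : cdom -> coord @` cdom]; both are irrelevant outside these sets. *)
Record chart (R : realType) (X : topologicalType) := Chart {
  cdom : set X;
  coord :> X -> Cplx R;
  icoord : Cplx R -> X;
  chart_dom_open : open cdom;
  chart_img_open : open (coord @` cdom);
  chart_continuous : {in cdom, continuous coord};
  ichart_continuous : {in coord @` cdom, continuous icoord};
  chartK : {in cdom, cancel coord icoord} }.

Record complex_atlas (R : realType) (X : topologicalType) := ComplexAtlas {
  chart_index : Type;
  chart_of :> chart_index -> chart R X;
  atlas_cover : forall x, exists i, cdom (chart_of i) x;
  atlas_compat : forall i j,
    holomorphic_on (chart_of i @` (cdom (chart_of i) `&` cdom (chart_of j)))
                   (chart_of j \o icoord (chart_of i)) }.

Record compact_riemann_surface (R : realType) := CompactRiemannSurface {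
  points :> topologicalType;
  atlas : complex_atlas R points;
  points_neq0 : [set: points] !=set0;
  points_hausdorff : hausdorff_space points;
  points_connected : connected [set: points];
  points_compact : compact [set: points] }.

Definition holomorphic_map (R : realType) (X Y : topologicalType)
    (A : complex_atlas R X) (B : complex_atlas R Y) (f : X -> Y) : Prop :=
  continuous f /\
  forall i j, holomorphic_on (A i @` (cdom (A i) `&` f @^-1` cdom (B j)))
                             (B j \o f \o icoord (A i)).

(* The standard n-simplex, with its subspace topology. *)
Definition simplex (R : realType) (n : nat) : set 'rV[R]_n.+1 :=
  [set x | (forall i, 0 <= x ord0 i) /\ \sum_i x ord0 i = 1].
Arguments simplex : clear implicits.

Section Face.
Variables (R : realType) (n : nat).
Implicit Types (i : 'I_n.+2).

Definition face_fun i (x : 'rV[R]_n.+1) : 'rV[R]_n.+2 :=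
  \row_j oapp (x ord0) 0 (unlift i j).

Lemma face_funP i (x : simplex R n) : face_fun i (val x) \in simplex R n.+1.
Proof.
have [x0 x1] := set_mem (valP x).
apply/mem_set; split => [j|].
  by rewrite mxE; case: unlift => //= k; exact: x0.
rewrite (bigD1_ord i)//= mxE unlift_none add0r -[RHS]x1.
by apply: eq_bigr => k _; rewrite mxE liftK.
Qed.

Definition face i (x : simplex R n) : simplex R n.+1 := SigSub (face_funP i x).

Lemma face_continuous i : continuous (face i).
Proof.
apply/continuous_comp_initial.
have -> : set_val \o face i = face_fun i \o set_val by [].
move=> x; apply: continuous_comp; first exact: initial_continuous.
move=> s /nbhs_ballP[e e0 es]; apply/nbhs_ballP; exists e => // y [_ xy].
apply: es; split => // j k; rewrite !mxE.
by case: unlift => [l|] /=; [exact: xy | exact: ballxx].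
Qed.

HB.instance Definition _ i :=
  @isContinuous.Build _ _ (face i) (@face_continuous i).

End Face.

Section Homology.
Variables (R : realType) (X : topologicalType).

Definition singular_simplex n := continuousType (simplex R n) X.

Definition chain n := {freeg (singular_simplex n)}.

Definition boundary_map n : chain n.+1 -> chain n :=
  fglift (fun s : singular_simplex n.+1 =>
    \sum_(i < n.+2) << (-1) ^+ i *g (s \o face i : singular_simplex n) >>).

Definition homologous n (c d : chain n) : Prop :=
  exists e : chain n.+1, boundary_map e = c - d.

(* The classes of the cycles [z i] form a basis of the abelian group
   H_{n+1}(X, Z). *)
Definition homology_basis n (I : finType) (z : I -> chain n.+1) : Prop :=
  (forall i, boundary_map (z i) = 0) /\
  forall c : chain n.+1, boundary_map c = 0 ->
    exists! a : {ffun I -> int}, homologous c (\sum_i z i *~ a i).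

End Homology.

Section Curves.
Variables (R : realType) (X : topologicalType) (A : complex_atlas R X).

Local Notation Re := (@complex.Re R).
Local Notation Im := (@complex.Im R).

Definition velocity (u : R -> Cplx R) (t : R) : Cplx R :=
  (derive1 (Re \o u) t +i* derive1 (Im \o u) t)%C.

(* A continuously differentiable map from the circle R/Z. On a connected surface
   every class in H_1(X, Z) is represented by such a loop. *)
Record loop := Loop {
  loop_fun :> R -> X;
  loop_continuous : continuous loop_fun;
  loop_periodic : forall t, loop_fun (t + 1) = loop_fun t;
  loop_C1 : forall i t, cdom (A i) (loop_fun t) ->
    [/\ derivable (Re \o (A i \o loop_fun)) t 1,
        derivable (Im \o (A i \o loop_fun)) t 1 &
        {for t, continuous (velocity (A i \o loop_fun))}] }.

Definition loop_simplex_fun (g : loop) (x : simplex R 1) : X :=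
  g (val x ord0 ord_max).

Lemma loop_simplex_continuous (g : loop) : continuous (loop_simplex_fun g).
Proof.
move=> x; apply: (@continuous_comp _ _ _ _ g); last exact: loop_continuous.
apply: (@continuous_comp _ _ _ _ (fun y : 'rV[R]_2 => y ord0 ord_max)).
  exact: initial_continuous.
exact: coord_continuous.
Qed.

HB.instance Definition _ (g : loop) :=
  @isContinuous.Build _ _ (loop_simplex_fun g) (@loop_simplex_continuous g).

Definition loop_chain (g : loop) : chain R X 1 :=
  << (loop_simplex_fun g : singular_simplex R X 1) >>.

Definition crossings (g d : loop) : set (R * R) :=
  [set p | [/\ 0 <= p.1 < 1, 0 <= p.2 < 1 & g p.1 = d p.2]].

Definition chart_at (x : X) : chart_index A := projT1 (cid (atlas_cover A x)).

(* The sign of the crossing: positive if the two velocities, in this order, form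
   a direct basis of the tangent plane for the complex orientation. *)
Definition orientation (g d : loop) (p : R * R) : R :=
  let i := chart_at (g p.1) in
  Im ((velocity (A i \o g) p.1)^* * velocity (A i \o d) p.2).

(* The intersection pairing on H_1, as a relation: the signed count of the
   crossings of transverse representatives, which does not depend on them. *)
Definition intersection_number (g d : loop) (k : int) : Prop :=
  exists g' d' : loop,
    [/\ homologous (loop_chain g) (loop_chain g'),
        homologous (loop_chain d) (loop_chain d'),
        finite_set (crossings g' d'),
        forall p, crossings g' d' p -> orientation g' d' p != 0 &
        k = \sum_(p \in crossings g' d') sgz (orientation g' d' p)].

Definition symplectic_basis h (a b : 'I_h -> loop) : Prop :=
  homology_basis (fun s : 'I_h + 'I_h =>
    match s with inl j => loop_chain (a j) | inr j => loop_chain (b j) end) /\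
  forall j k, [/\ intersection_number (a j) (a k) 0,
                  intersection_number (b j) (b k) 0 &
                  intersection_number (a j) (b k) (j == k)].

(* A one-form of type (1,0) is given by its coefficients [w i], with
   w = w_i dz_i on the domain of the chart z_i. *)
Definition oneform := chart_index A -> X -> Cplx R.

Definition holomorphic_oneform (w : oneform) : Prop :=
  (forall i, holomorphic_on (A i @` cdom (A i)) (w i \o icoord (A i))) /\
  (forall i j x, cdom (A i) x -> cdom (A j) x ->
     w i x = w j x * derive1 (A j \o icoord (A i)) (A i x)).

Definition oneform_basis h (w : 'I_h -> oneform) : Prop :=
  (forall k, holomorphic_oneform (w k)) /\
  forall e, holomorphic_oneform e -> exists! v : 'rV[Cplx R]_h,
    forall i x, cdom (A i) x -> e i x = \sum_k v ord0 k * w k i x.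

Definition integrand (w : oneform) (g : loop) (t : R) : Cplx R :=
  let i := chart_at (g t) in w i (g t) * velocity (A i \o g) t.

Definition period (w : oneform) (g : loop) : Cplx R :=
  (\int[lebesgue_measure]_(t in `[0, 1]) Re (integrand w g t) +i*
   \int[lebesgue_measure]_(t in `[0, 1]) Im (integrand w g t))%C.

Definition period_matrix h (w : 'I_h -> oneform) (b : 'I_h -> loop) :
  'M[Cplx R]_h := \matrix_(j, k) period (w k) (b j).

End Curves.

(* H_1(X, Z) is free of rank 2h. *)
Definition has_genus (R : realType) (X : topologicalType) (h : nat) : Prop :=
  exists z : 'I_h.*2 -> chain R X 1, homology_basis z.

Section Torus.
Variables (R : realType) (tau : Cplx R).
Local Notation C := (Cplx R).
Local Open Scope quotient_scope.

Definition lattice : set C :=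
  [set z | exists m n : int, z = m%:~R + n%:~R * tau].

Definition lattice_rel : rel C := fun z w => `[< lattice (z - w) >].

Lemma lattice0 : lattice 0.
Proof. by exists 0, 0; rewrite mul0r addr0. Qed.

Lemma latticeN z : lattice z -> lattice (- z).
Proof.
by move=> [m [n ->]]; exists (- m), (- n); rewrite !rmorphN mulNr opprD.
Qed.

Lemma latticeD z w : lattice z -> lattice w -> lattice (z + w).
Proof.
move=> [m [n ->]] [p [q ->]]; exists (m + p), (n + q).
by rewrite !rmorphD mulrDl addrACA.
Qed.

Lemma lattice_rel_refl : reflexive lattice_rel.
Proof. by move=> z; apply/asboolP; rewrite subrr; exact: lattice0. Qed.

Lemma lattice_rel_sym : symmetric lattice_rel.
Proof.
by move=> z w; apply/asbool_equiv_eq; split=> /latticeN; rewrite opprB.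
Qed.

Lemma lattice_rel_trans : transitive lattice_rel.
Proof.
move=> w z u /asboolP zw /asboolP wu; apply/asboolP.
by have := latticeD zw wu; rewrite addrA subrK.
Qed.

Canonical lattice_equiv_rel :=
  EquivRel lattice_rel lattice_rel_refl lattice_rel_sym lattice_rel_trans.

Definition torus := quotient_topology {eq_quot lattice_rel}.

HB.instance Definition _ := Topological.on torus.
HB.instance Definition _ := Quotient.on torus.

Definition torus_pi : C -> torus := \pi_torus.

Lemma torus_piP z w : torus_pi z = torus_pi w <-> lattice (z - w).
Proof.
rewrite -(asboolE (lattice (z - w))).
exact: (rwP (@eqmodP _ lattice_equiv_rel z w)).
Qed.

Lemma torus_pi_continuous : continuous torus_pi.
Proof. exact: pi_continuous. Qed.

Lemma torus_pi_surj x : torus_pi (repr x) = x.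
Proof. exact: reprK. Qed.

Lemma torus_pi_open (U : set C) : open U -> open (torus_pi @` U).
Proof.
move=> Uo.
have -> : open (torus_pi @` U) = open (torus_pi @^-1` (torus_pi @` U)) by [].
have -> : torus_pi @^-1` (torus_pi @` U) =
    \bigcup_(l in lattice) ((fun w : C => w + l) @^-1` U).
  apply/seteqP; split=> [w [z Uz /torus_piP zw]|w [l ll Uw]].
    by exists (z - w) => //=; rewrite addrC subrK.
  by exists (w + l) => //; apply/torus_piP; rewrite addrAC subrr add0r.
apply: bigcup_open => l _.
have /continuousP : continuous (fun w : C => w + l).
  by move=> w; exact: cvgD cvg_id (cvg_cst _).
exact.
Qed.

(* The charts of the torus are the inverses of the restrictions of the
   projection to discs too small to contain two equivalent points. *)
Definition torus_radius : C := ((Num.min 1 (complex.Im tau) / 2)%:C)%C.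

Definition torus_disc (a : C) : set C := [set z | `|z - a| < torus_radius].

Definition torus_lift (a : C) (x : torus) : C :=
  xget a (torus_disc a `&` [set z | torus_pi z = x]).

Hypothesis tau_gt0 : 0 < complex.Im tau.

Lemma lattice_gap z : lattice z -> `|z| < torus_radius + torus_radius -> z = 0.
Proof.
have ImM (n : int) (x : C) : complex.Im (n%:~R * x) = n%:~R * complex.Im x.
  by rewrite mulrzl raddfMz mulrzl.
have -> : torus_radius + torus_radius = ((Num.min 1 (complex.Im tau))%:C)%C.
  by rewrite -rmorphD -splitr.
have int_lt1 (n : int) : `|n%:~R| < 1 :> R -> n = 0.
  by rewrite -intr_norm -[1]/(1%:~R) ltr_int; case: n => [[]|].
move=> [m [n ->]].
rewrite normc_def ltcR lt_min => /andP[m1 n1].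
have Imz : complex.Im (m%:~R + n%:~R * tau : C) = n%:~R * complex.Im tau.
  by rewrite raddfD /= ImM -[m%:~R]mulr1 ImM /= mulr0 add0r.
have n0 : n = 0.
  apply: int_lt1; rewrite -(@ltr_pM2r _ (complex.Im tau))// mul1r.
  apply: le_lt_trans n1; rewrite -[X in _ * X]gtr0_norm// -normrM -Imz.
  by rewrite -sqrtr_sqr ler_wsqrtr// lerDr sqr_ge0.
rewrite n0 mul0r addr0 (int_lt1 m) //; apply: le_lt_trans m1.
have -> : m%:~R = complex.Re (m%:~R + n%:~R * tau : C) :> R.
  rewrite n0 mul0r addr0.
  by rewrite raddfMz.
by rewrite -sqrtr_sqr ler_wsqrtr// lerDl sqr_ge0.
Qed.

Lemma torus_disc_inj a z w : torus_disc a z -> torus_disc a w ->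
  torus_pi z = torus_pi w -> z = w.
Proof.
move=> az aw /torus_piP zw; apply/eqP; rewrite -subr_eq0; apply/eqP.
apply: lattice_gap => //; rewrite -(subrKA a).
rewrite (le_lt_trans (ler_normD _ _))// ltrD// [ltLHS]distrC; exact: aw.
Qed.

Lemma torus_disc_open a : open (torus_disc a).
Proof.
rewrite openE => z az; apply/nbhs_ballP; exists (torus_radius - `|z - a|) => /=.
  by rewrite subr_gt0.
move=> w; rewrite -ball_normE /ball_/= => zw; rewrite /torus_disc/=.
rewrite -(subrKA z) (le_lt_trans (ler_normD _ _))// distrC -ltrBrDr.
exact: zw.
Qed.

Lemma torus_liftP a x : (torus_pi @` torus_disc a) x ->
  torus_disc a (torus_lift a x) /\ torus_pi (torus_lift a x) = x.
Proof.
by move=> [z az zx]; apply: (@xgetPex _ a (torus_disc a `&` _)); exists z.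
Qed.

Lemma torus_liftK a z : torus_disc a z -> torus_lift a (torus_pi z) = z.
Proof.
move=> az; have [] := @torus_liftP a (torus_pi z); first by exists z.
by move=> la lz; exact: (torus_disc_inj la az lz).
Qed.

Lemma torus_lift_img a :
  torus_lift a @` (torus_pi @` torus_disc a) = torus_disc a.
Proof.
apply/seteqP; split=> [_ [x /torus_liftP[+ _] <-]|z az]//.
by exists (torus_pi z); [exists z | exact: torus_liftK].
Qed.

Lemma torus_lift_continuous a :
  {in torus_pi @` torus_disc a, continuous (torus_lift a)}.
Proof.
move=> _ /set_mem [z az <-] V; rewrite torus_liftK// nbhsE => -[W [Wo Wz] WV].
rewrite nbhs_simpl /= nbhsE; exists (torus_pi @` (torus_disc a `&` W)).
  split; last by exists z.
  by apply: torus_pi_open; apply: openI => //; exact: torus_disc_open.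
by move=> _ [w [aw Ww] <-]; apply: WV; rewrite /= torus_liftK.
Qed.

Program Definition torus_chart (a : C) : chart R torus :=
  @Chart R torus (torus_pi @` torus_disc a) (torus_lift a) torus_pi
    _ _ (@torus_lift_continuous a) _ _.
Next Obligation. by move=> a; exact/torus_pi_open/torus_disc_open. Qed.
Next Obligation. by move=> a; rewrite torus_lift_img; exact: torus_disc_open. Qed.
Next Obligation. by move=> a z _; exact: torus_pi_continuous. Qed.
Next Obligation. by move=> a x /set_mem/torus_liftP[]. Qed.

Lemma torus_cover x : exists a, cdom (torus_chart a) x.
Proof.
exists (repr x), (repr x); last exact: torus_pi_surj.
rewrite /torus_disc /= subrr normr0 ltcR divr_gt0//.
by rewrite lt_min ltr01.
Qed.

Lemma torus_compat a b :
  holomorphic_on (torus_chart a @` (cdom (torus_chart a) `&`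
                                    cdom (torus_chart b)))
                 (torus_chart b \o icoord (torus_chart a)).
Proof.
move=> _ [_ [[z az <-] [w bw /torus_piP wz]] <-] /=; rewrite torus_liftK//.
apply: (@near_eq_derivable _ _ _ (fun u : C => u + (w - z))); last first.
  by apply: derivableD; [exact: derivable_id | exact: derivable_cst].
have bz : \forall u \near z, torus_disc b (u + (w - z)).
  have /continuousP/(_ _ (@torus_disc_open b)) :
      continuous (fun u : C => u + (w - z)).
    by move=> u; exact: cvgD cvg_id (cvg_cst _).
  by rewrite openE; apply; rewrite /= addrC subrK.
near=> u; rewrite /= -[LHS](@torus_liftK b).
  by congr torus_lift; apply/torus_piP; rewrite addrAC subrr add0r.
by near: u.
Unshelve. all: by end_near. Qed.

Definition torus_atlas : complex_atlas R torus :=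
  @ComplexAtlas R torus C torus_chart torus_cover torus_compat.

End Torus.

(* Main.v *)
(* Writing v = p + q tau for the alpha periods of a form and r + s tau for its
   beta periods, condition (i) with conj c = - tau says precisely that the
   nonzero form w = sum_k v_k w_k has all its periods in the lattice Z + Z tau.
   Given such a form, the map x |-> int^x w to C / (Z + Z tau) is well defined,
   since the periods over any cycle are integral combinations of those over a
   homology basis, and it is not constant since its differential is w.
   Conversely the pull-back of dz by a map to a torus is such a form. The only
   other ingredient is that a form with real periods vanishes: the imaginary
   part of its primitive is a harmonic function on a compact surface. This
   excludes q = s = 0 in one direction and a real c in the other.

   Forms are integrated along continuous simplices by gluing local primitives.
   The local theory rests on Goursat's theorem, with one exceptional point
   allowed: applied to difference quotients it yields the Cauchy formula, hence
   the holomorphy of derivatives, and the maximum principle. *)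
Require Import Defs.
From HB Require Import structures.
From mathcomp Require Import all_boot all_order all_algebra.
From mathcomp Require Import all_classical all_reals all_analysis.
From mathcomp Require Import complex ring lra.
From mathcomp.multinomials Require Import freeg.

Set Implicit Arguments.
Unset Strict Implicit.
Unset Printing Implicit Defensive.

Import Order.TTheory GRing.Theory Num.Theory numFieldNormedType.Exports.

Local Open Scope classical_set_scope.
Local Open Scope ring_scope.

(** Two obstacles shape the proof. Holomorphy is given as bare complex differentiability, with no
    continuity of the derivative: hence Goursat's theorem, and hence the need to prove that the
    coefficient of a pulled-back dz, which is a derivative, is again holomorphic. And homology is
    made of merely continuous simplices, which have no velocity to integrate a form against. The
    integral over such a simplex is therefore the increment of a function that, near each parameter,
    agrees up to a constant with a local primitive composed with the simplex. Germs of primitives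
    are unique up to constants, so most comparisons reduce to one fact: a locally constant function
    on a segment is constant. A primitive on a square mapped onto a triangle shows that boundaries
    integrate to zero, which lets the homology basis control all cycles. The integral in [period] is
    compared with this notion once, in [period_intS]. *)

Local Notation Re := (@complex.Re _).
Local Notation Im := (@complex.Im _).

(** * Moduli and derivatives *)

Section Modulus.
Variable R : realType.
Notation C := (Cplx R).
Implicit Types (z w : C) (x y : R).

(** The norm of [Cplx R] takes values in [Cplx R] itself; estimates use this real-valued modulus,
    within reach of [lra] and of the order on [R]. *)
Definition cmod z : R := Re `|z|.
Definition rc x : C := (x%:C)%C.
Definition ii : C := (0 +i* 1)%C.

Lemma normCE z : `|z| = (cmod z)%:C%C.
Proof. by rewrite /cmod normc_def. Qed.

Lemma cmodE z : cmod z = Num.sqrt (Re z ^+ 2 + Im z ^+ 2).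
Proof. by rewrite /cmod normc_def. Qed.

Lemma cmod_ge0 z : 0 <= cmod z.
Proof. by rewrite cmodE sqrtr_ge0. Qed.

Lemma cmodM z w : cmod (z * w) = cmod z * cmod w.
Proof. by apply: complexI; rewrite rmorphM /= -!normCE normrM. Qed.

Lemma cmodD z w : cmod (z + w) <= cmod z + cmod w.
Proof. by rewrite -lecR rmorphD /= -!normCE ler_normD. Qed.

Lemma cmodN z : cmod (- z) = cmod z.
Proof. by rewrite /cmod normrN. Qed.

Lemma cmodB z w : cmod (z - w) <= cmod z + cmod w.
Proof. by rewrite -(cmodN w) cmodD. Qed.

Lemma cmod_distC z w : cmod (z - w) = cmod (w - z).
Proof. by rewrite -cmodN opprB. Qed.

Lemma cmod_dist_trans u z w : cmod (z - w) <= cmod (z - u) + cmod (u - w).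
Proof. by rewrite -[z - w](subrKA u) cmodD. Qed.

Lemma cmod0 : cmod 0 = 0. Proof. by rewrite /cmod normr0. Qed.

Lemma cmod1 : cmod 1 = 1. Proof. by rewrite /cmod normr1. Qed.

Lemma cmod_eq0 z : (cmod z == 0) = (z == 0).
Proof.
by rewrite -[RHS]normr_eq0 normCE eq_complex /= eqxx andbT.
Qed.

Lemma cmod_gt0 z : (0 < cmod z) = (z != 0).
Proof. by rewrite lt_neqAle cmod_ge0 andbT eq_sym cmod_eq0. Qed.

Lemma cmodV z : cmod z^-1 = (cmod z)^-1.
Proof.
by apply: complexI; rewrite fmorphV /= -!normCE normfV.
Qed.

Lemma cmod_rc x : cmod (rc x) = `|x|.
Proof. by rewrite cmodE /= expr0n addr0 sqrtr_sqr. Qed.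

Lemma cmod_Re z : `|Re z| <= cmod z.
Proof. by rewrite cmodE -sqrtr_sqr ler_wsqrtr // lerDl sqr_ge0. Qed.

Lemma cmod_Im z : `|Im z| <= cmod z.
Proof. by rewrite cmodE -sqrtr_sqr ler_wsqrtr // lerDr sqr_ge0. Qed.

Lemma cmod_ii : cmod ii = 1.
Proof. by rewrite cmodE /= expr0n expr1n add0r sqrtr1. Qed.

Lemma complexRI z : z = rc (Re z) + ii * rc (Im z).
Proof.
by case: z => a b; apply/eqP; rewrite eq_complex /= !mul0r !mulr0 mul1r
  subrr addr0 !add0r !eqxx.
Qed.

Lemma cmod_le z : cmod z <= `|Re z| + `|Im z|.
Proof.
rewrite [z in leLHS]complexRI (le_trans (cmodD _ _)) //.
by rewrite cmodM cmod_ii mul1r !cmod_rc.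
Qed.

Lemma cmod_conj z : cmod z^* = cmod z.
Proof. by rewrite /cmod norm_conjC. Qed.

Lemma cReB z w : Re (z - w) = Re z - Re w. Proof. exact: raddfB. Qed.
Lemma cImB z w : Im (z - w) = Im z - Im w. Proof. exact: raddfB. Qed.
Lemma cImD z w : Im (z + w) = Im z + Im w. Proof. exact: raddfD. Qed.
Lemma cReM z w : Re (z * w) = Re z * Re w - Im z * Im w.
Proof. by case: z w => [a b] [c d]. Qed.
Lemma cImM z w : Im (z * w) = Re z * Im w + Im z * Re w.
Proof. by case: z w => [a b] [c d]. Qed.
Lemma cRe_conj z : Re z^* = Re z. Proof. by case: z. Qed.
Lemma cIm_conj z : Im z^* = - Im z. Proof. by case: z. Qed.
Lemma rcB x y : rc (x - y) = rc x - rc y. Proof. exact: rmorphB. Qed.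

Lemma complexP z w : Re z = Re w -> Im z = Im w -> z = w.
Proof. by case: z w => [a b] [c d] /= -> ->. Qed.

Lemma cmod_le_eps z : (forall e, 0 < e -> cmod z <= e) -> z = 0.
Proof.
move=> h; apply/eqP; rewrite -cmod_eq0 eq_le cmod_ge0 andbT.
by apply/ler_addgt0Pr => e e0; rewrite add0r h.
Qed.

(** Passage from the balls of the normed structure, whose radii are complex, to real radii: a
    positive complex number equals its real part. *)
Lemma nbhs_cplx z (A : set C) :
  nbhs z A <-> exists2 d : R, 0 < d & forall w, cmod (w - z) < d -> A w.
Proof.
split=> [/nbhs_ballP[e /= e0 eA]|[d d0 dA]].
  exists (Re e); first by move: e0; rewrite ltcE => /andP[].
  move=> w wz; apply: eA; rewrite -ball_normE /ball_/= distrC normCE ltcE/=.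
  by rewrite wz andbT; move: e0; rewrite ltcE => /andP[/eqP /= ->].
apply/nbhs_ballP; exists (rc d) => /=; first by rewrite ltcR.
move=> w; rewrite -ball_normE /ball_/= distrC normCE ltcR.
exact: dA.
Qed.

End Modulus.
Arguments ii {R}.

Section Derivative.
Variable R : realType.
Notation C := (Cplx R).

(* [i] is the coordinate with respect to which the derivative is taken:
   the identity for a complex, the inclusion of the reals for a real one. *)
Definition der (T : Type) (i : T -> C) (f : T -> C) (t : T) (v : C) : Prop :=
  forall e : R, 0 < e -> exists2 d : R, 0 < d &
    forall s, cmod (i s - i t) < d ->
      cmod (f s - f t - v * (i s - i t)) <= e * cmod (i s - i t).

Definition cder := der (fun z : C => z).
Definition rder := der (@rc R).

Section General.
Variables (T : Type) (i : T -> C).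
Implicit Types (f g : T -> C) (t : T) (u v c : C).

Lemma der_cst c t : der i (fun=> c) t 0.
Proof.
move=> e e0; exists 1 => // s _; rewrite subrr sub0r mul0r oppr0 cmod0.
by rewrite mulr_ge0 ?cmod_ge0 // ltW.
Qed.

Lemma der_id t : der i i t 1.
Proof.
move=> e e0; exists 1 => // s _; rewrite mul1r subrr cmod0.
by rewrite mulr_ge0 ?cmod_ge0 // ltW.
Qed.

Lemma derD f g t u v : der i f t u -> der i g t v ->
  der i (fun s => f s + g s) t (u + v).
Proof.
move=> fu gv e e0; have e20 : 0 < e / 2 by rewrite divr_gt0.
have [d1 d10 h1] := fu _ e20; have [d2 d20 h2] := gv _ e20.
exists (Num.min d1 d2) => [|s]; first by rewrite lt_min d10.
rewrite lt_min => /andP[/h1 l1 /h2 l2].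
have -> : f s + g s - (f t + g t) - (u + v) * (i s - i t) =
  (f s - f t - u * (i s - i t)) + (g s - g t - v * (i s - i t)) by ring.
by rewrite (le_trans (cmodD _ _)) // [e]splitr mulrDl lerD.
Qed.

Lemma derZ f t u c : der i f t u -> der i (fun s => c * f s) t (c * u).
Proof.
move=> fu e e0; have k0 : 0 < cmod c + 1 by rewrite ltr_wpDl ?cmod_ge0.
have [d d0 h] := fu _ (divr_gt0 e0 k0).
exists d => // s /h l.
have -> : c * f s - c * f t - c * u * (i s - i t) =
  c * (f s - f t - u * (i s - i t)) by ring.
rewrite cmodM (le_trans (ler_wpM2l (cmod_ge0 c) l)) // mulrA.
rewrite ler_wpM2r ?cmod_ge0 // mulrA ler_pdivrMr // mulrC ler_wpM2l ?ltW //.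
by rewrite ltrDl.
Qed.

Lemma der_ext f g t v : (forall s, f s = g s) -> der i f t v -> der i g t v.
Proof. by move=> fg; rewrite (_ : f = g) //; apply/funext. Qed.

Lemma derN f t v : der i f t v -> der i (fun s => - f s) t (- v).
Proof.
move=> /(derZ (-1)); rewrite mulN1r; apply: der_ext => s; exact: mulN1r.
Qed.

Lemma derB f g t u v : der i f t u -> der i g t v ->
  der i (fun s => f s - g s) t (u - v).
Proof. by move=> fu /derN; exact: derD. Qed.

Lemma der_eps f g t v (d : R) : 0 < d ->
  (forall s, cmod (i s - i t) < d -> f s = g s) -> der i f t v -> der i g t v.
Proof.
move=> d0 fg fv e e0; have [d1 d10 h] := fv _ e0.
exists (Num.min d d1) => [|s]; first by rewrite lt_min d0.
rewrite lt_min => /andP[sd sd1].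
by rewrite -!fg ?subrr ?cmod0 //; exact: h.
Qed.

Lemma der_lip f t v : der i f t v -> exists2 d : R, 0 < d &
  forall s, cmod (i s - i t) < d ->
    cmod (f s - f t) <= (cmod v + 1) * cmod (i s - i t).
Proof.
move=> fv; have [d d0 h] := fv 1 ltr01; exists d => // s /h l.
rewrite -(subrK (v * (i s - i t)) (f s - f t)) (le_trans (cmodD _ _)) //.
by rewrite mulrDl addrC lerD ?cmodM.
Qed.

Lemma der_cont f t v : der i f t v -> forall e : R, 0 < e -> exists2 d : R, 0 < d &
  forall s, cmod (i s - i t) < d -> cmod (f s - f t) < e.
Proof.
move=> /der_lip[d d0 h] e e0.
have k0 : 0 < cmod v + 1 by rewrite ltr_wpDl ?cmod_ge0.
exists (Num.min d (e / (cmod v + 1))) => [|s].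
  by rewrite lt_min d0 divr_gt0.
rewrite lt_min => /andP[/h l1 l2]; apply: le_lt_trans l1 _.
by rewrite mulrC -ltr_pdivlMr.
Qed.

Lemma derM f g t u v : der i f t u -> der i g t v ->
  der i (fun s => f s * g s) t (u * g t + f t * v).
Proof.
move=> fu gv.
(* The product of the increments is negligible, and [f * g] differs from it by an affine combination
   of [f] and [g]. *)
have : der i (fun s => (f s - f t) * (g s - g t)) t 0.
  move=> e e0; have [d1 d10 h1] := der_cont fu e0.
  have k0 : 0 < cmod v + 1 by rewrite ltr_wpDl ?cmod_ge0.
  have [d1' d10' h1'] := der_cont fu (divr_gt0 e0 k0).
  have [d2 d20 h2] := der_lip gv.
  exists (Num.min d1' d2) => [|s]; first by rewrite lt_min d10'.
  rewrite lt_min => /andP[/h1' l1 /h2 l3].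
  rewrite !subrr mul0r subr0 mul0r subr0 cmodM.
  rewrite (le_trans (ler_wpM2l (cmod_ge0 _) l3)) // mulrA ler_wpM2r ?cmod_ge0 //.
  by rewrite -ler_pdivlMr // ltW.
move=> /derD /(_ (derD (derZ (g t) fu) (derZ (f t) gv))).
have gg : der i (fun=> - (f t * g t)) t 0 by exact: der_cst.
move=> /derD /(_ gg); rewrite add0r addr0 [g t * u]mulrC.
by apply: der_ext => s; ring.
Qed.

Lemma der_comp f (F : C -> C) t u v : der i f t v -> cder F (f t) u ->
  der i (F \o f) t (u * v).
Proof.
move=> fv Fu e e0.
have k0 : 0 < cmod v + 1 by rewrite ltr_wpDl ?cmod_ge0.
have k1 : 0 < cmod u + 1 by rewrite ltr_wpDl ?cmod_ge0.
have e20 : 0 < e / 2 by rewrite divr_gt0.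
have [d1 d10 h1] := Fu _ (divr_gt0 e20 k0).
have [d2 d20 h2] := fv _ (divr_gt0 e20 k1).
have [d3 d30 h3] := der_lip fv.
have [d4 d40 h4] := der_cont fv d10.
exists (Num.min (Num.min d2 d3) d4) => [|s]; first by rewrite !lt_min d20 d30.
rewrite !lt_min => /andP[/andP[/h2 l2 /h3 l3'] /h4 /h1 l1] /=.
have -> : F (f s) - F (f t) - u * v * (i s - i t) =
  (F (f s) - F (f t) - u * (f s - f t)) + u * (f s - f t - v * (i s - i t)).
  by ring.
rewrite (le_trans (cmodD _ _)) // [e in leRHS]splitr mulrDl lerD //.
  rewrite (le_trans l1) // (le_trans (ler_wpM2l _ l3')) ?(ltW (divr_gt0 e20 k0)) //.
  by rewrite mulrA divfK ?gt_eqF.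
rewrite cmodM (le_trans (ler_wpM2l (cmod_ge0 u) l2)) // mulrA.
rewrite ler_wpM2r ?cmod_ge0 // mulrA ler_pdivrMr // mulrC ler_wpM2l ?ltW //.
by rewrite ltrDl.
Qed.

End General.

Lemma cder_inv (z : C) : z != 0 -> cder (fun w => w^-1) z (- (z^-1 * z^-1)).
Proof.
move=> z0 e e0; have r0 : 0 < cmod z by rewrite cmod_gt0.
(* The remainder is (w - z)^2 / (w z^2). Where |w| > |z| / 2, the factor 1 / |w z^2| is below 2 /
   |z|^3, the inverse of the constant used here. *)
have m0 : 0 < e * (cmod z ^+ 3 / 2) by rewrite mulr_gt0 // divr_gt0 // exprn_gt0.
exists (Num.min (cmod z / 2) (e * (cmod z ^+ 3 / 2))) => [|w].
  by rewrite lt_min m0 divr_gt0.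
rewrite lt_min => /andP[wz we].
have wr : cmod z / 2 < cmod w.
  have := cmod_dist_trans w z 0; rewrite !subr0 cmod_distC => h.
  by move: h wz; move: (cmod _) (cmod _) (cmod _) => a b c; lra.
have w0 : w != 0 by rewrite -cmod_gt0; apply: lt_trans wr; rewrite divr_gt0.
have -> : w^-1 - z^-1 - - (z^-1 * z^-1) * (w - z) =
  (w - z) * (w^-1 * (z^-1 * z^-1)) * (w - z) by field; rewrite w0 z0.
rewrite cmodM ler_wpM2r ?cmod_ge0 // !cmodM !cmodV.
rewrite (le_trans (ler_wpM2r _ (ltW we))) //.
  by rewrite !mulr_ge0 ?invr_ge0 ?cmod_ge0.
rewrite -mulrA ler_piMr ?ltW //.
have -> : cmod z ^+ 3 / 2 * ((cmod w)^-1 * ((cmod z)^-1 / cmod z)) =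
   (cmod z / 2) / cmod w by field; rewrite !gt_eqF // (lt_trans _ wr) ?divr_gt0.
by rewrite ltr_pdivrMr ?mul1r // (lt_trans _ wr) ?divr_gt0.
Qed.

Lemma cder_uniq (f : C -> C) z u v : cder f z u -> cder f z v -> u = v.
Proof.
move=> fu fv; apply/eqP; rewrite -subr_eq0; apply/eqP/cmod_le_eps => e e0.
have [d d0 /(_ (z + rc (d / 2)))] := derB fu fv e0.
have d20 : 0 < d / 2 by rewrite divr_gt0.
rewrite [z + _ - z]addrC addKr cmod_rc gtr0_norm // => h.
have {}h := h ltac:(by rewrite ltr_pdivrMr // mulr_natr mulr2n ltrDl).
move: h; rewrite !subrr sub0r cmodN cmodM cmod_rc gtr0_norm //.
by rewrite ler_pM2r.
Qed.

Lemma cder_derivable (f : C -> C) z v :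
  cder f z v <-> derivable f z 1 /\ derive1 f z = v.
Proof.
have shift (h : C) : h *: (1 : C) + z - z = h by rewrite addrK [_ *: _]mulr1.
have cvgE : cder f z v <-> h^-1 *: (f (h *: 1 + z) - f z) @[h --> 0^'] --> v.
  split.
    move=> fv; apply/cvgrPdist_le => e e0.
    have [e0' eE] : 0 < Re e /\ e = rc (Re e).
      by move: e0; rewrite ltcE /= => /andP[/eqP eI ->]; split => //;
        apply: complexP.
    have [d d0 h] := fv _ e0'.
    apply/nbhs_cplx; exists d => // w.
    rewrite subr0 => wd w0.
    have := h (w *: 1 + z); rewrite shift => /(_ wd) l.
    rewrite normCE eE lecR cmod_distC -(@ler_pM2l _ (cmod w)) ?cmod_gt0 //.
    rewrite -cmodM mulrBr [_ *: (f _ - _)]/(_ * _) mulrA mulfV // mul1r.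
    by rewrite [w * v]mulrC [leRHS]mulrC.
  move=> /cvgrPdist_le h e e0.
  have : 0 < rc e by rewrite ltcR.
  move=> {}/h /nbhs_cplx[d d0 h].
  exists d => // w wd.
  have [->|wz] := eqVneq w z; first by rewrite !subrr mulr0 subr0 cmod0 mulr0.
  have := h (w - z); rewrite subr0 subr_eq0 => /(_ wd wz).
  rewrite normCE lecR cmod_distC -(@ler_pM2l _ (cmod (w - z))) ?cmod_gt0 ?subr_eq0 //.
  rewrite -cmodM mulrBr [_ *: (f _ - _)]/(_ * _) mulrA mulfV ?subr_eq0 // mul1r.
  by rewrite [(w - z) *: 1]mulr1 subrK [_ * v]mulrC [leRHS]mulrC.
rewrite cvgE; split=> [h|[h <-]].
  split; first by apply/cvg_ex; exists v.
  by rewrite derive1E; exact/cvg_lim.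
by rewrite derive1E; exact: h.
Qed.

Lemma derivable_cder (f : C -> C) z : derivable f z 1 -> cder f z (derive1 f z).
Proof. by move=> fz; apply/cder_derivable. Qed.

End Derivative.

(** * Complex functions of a real variable *)

Section RealVariable.
Variable R : realType.
Notation C := (Cplx R).
Implicit Types (u : R -> C) (v : C) (t a b : R).

Lemma is_derive_eps (f : R -> R) t (l : R) : is_derive t 1 f l <->
  forall e : R, 0 < e -> exists2 d : R, 0 < d &
    forall s, `|s - t| < d -> `|f s - f t - l * (s - t)| <= e * `|s - t|.
Proof.
have shift (h : R) : h *: (1 : R) + t - t = h by rewrite addrK [_ *: _]mulr1.
have cvgE : is_derive t 1 f l <-> h^-1 *: (f (h *: 1 + t) - f t) @[h --> 0^'] --> l.
  split=> [h|h].
    by case: h => d; rewrite /derive => <-.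
  apply: DeriveDef; first by apply/cvg_ex; exists l.
  by rewrite /derive; exact/cvg_lim.
rewrite cvgE; split.
  move=> /cvgrPdist_le h e e0; have := h e e0; rewrite /dnbhs /within /=.
  move=> /nbhs_ballP[d /= d0 {}h]; exists d => // s sd.
  have [->|st] := eqVneq s t; first by rewrite !subrr mulr0 subr0 normr0 mulr0.
  have := h (s - t); rewrite /ball /= sub0r normrN subr_eq0 => /(_ sd st).
  rewrite distrC -(@ler_pM2l _ `|s - t|) ?normr_gt0 ?subr_eq0 //.
  rewrite -normrM mulrBr [_ *: (f _ - _)]/(_ * _) mulrA mulfV ?subr_eq0 // mul1r.
  by rewrite [(s - t) *: 1]mulr1 subrK [_ * l]mulrC [leRHS]mulrC.
move=> h; apply/cvgrPdist_le => e e0.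
have [d d0 {}h] := h e e0.
apply/nbhs_ballP; exists d => //= s; rewrite /ball /= sub0r normrN => sd s0.
have := h (s *: 1 + t); rewrite shift => /(_ sd) l1.
rewrite distrC -(@ler_pM2l _ `|s|) ?normr_gt0 //.
rewrite -normrM mulrBr [_ *: (f _ - _)]/(_ * _) mulrA mulfV // mul1r.
by rewrite [s * l]mulrC [leRHS]mulrC.
Qed.

Lemma rder_is_derive u t v : rder u t v <->
  is_derive t 1 (Re \o u) (Re v) /\ is_derive t 1 (Im \o u) (Im v).
Proof.
have rcE s : cmod (rc s - rc t) = `|s - t| by rewrite -rcB cmod_rc.
have ReE s : Re (u s) - Re (u t) - Re v * (s - t) =
    Re (u s - u t - v * (rc s - rc t)).
  by rewrite -rcB !cReB cReM /= mulr0 subr0.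
have ImE s : Im (u s) - Im (u t) - Im v * (s - t) =
    Im (u s - u t - v * (rc s - rc t)).
  by rewrite -rcB !cImB cImM /= mulr0 add0r.
split=> [h|[/is_derive_eps h1 /is_derive_eps h2] e e0].
  split; apply/is_derive_eps => e /h[d d0 {}h]; exists d => // s sd;
    (have := h s; rewrite rcE => /(_ sd)); apply: le_trans; rewrite /= ?ReE ?ImE.
    exact: cmod_Re.
  exact: cmod_Im.
have e20 : 0 < e / 2 by rewrite divr_gt0.
have [d1 d10 {}h1] := h1 _ e20; have [d2 d20 {}h2] := h2 _ e20.
exists (Num.min d1 d2) => [|s]; first by rewrite lt_min d10.
rewrite rcE lt_min => /andP[/h1 l1 /h2 l2].
rewrite (le_trans (cmod_le _)) // [e]splitr mulrDl lerD //.
  by rewrite -ReE.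
by rewrite -ImE.
Qed.

Lemma rder_Re u t v : rder u t v -> is_derive t 1 (Re \o u) (Re v).
Proof. by case/rder_is_derive. Qed.

Lemma rder_Im u t v : rder u t v -> is_derive t 1 (Im \o u) (Im v).
Proof. by case/rder_is_derive. Qed.

Lemma is_derive_continuous_within (f df : R -> R) a b :
  (forall t, a <= t <= b -> is_derive t 1 f (df t)) ->
  {within `[a, b], continuous f}.
Proof.
move=> h; apply: derivable_within_continuous => t; rewrite in_itv => /h.
by case.
Qed.

Lemma MVT_is_derive (f df : R -> R) a b : a <= b ->
  (forall t, a <= t <= b -> is_derive t 1 f (df t)) ->
  exists2 c, a <= c <= b & f b - f a = df c * (b - a).
Proof.
move=> ab h.
have [c] := @MVT_segment _ f df a b ab (fun t (tab : t \in `]a, b[%R) =>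
  h t ltac:(by move: tab; rewrite in_itv /= => /andP[/ltW -> /ltW ->]))
  (is_derive_continuous_within h).
by rewrite in_itv /= => ? ?; exists c.
Qed.

(* The mean value theorem is applied to the real function
   [Re (conj (u b - u a) * u t)]. *)
Lemma rder_le u (v : R -> C) a b (M : R) : a <= b ->
  (forall t, a <= t <= b -> rder u t (v t)) ->
  (forall t, a <= t <= b -> cmod (v t) <= M) ->
  cmod (u b - u a) <= M * (b - a).
Proof.
move=> ab uv vM; set D := u b - u a.
have [c cab] : exists2 c, a <= c <= b & Re (D^* * u b) - Re (D^* * u a)
    = Re (D^* * v c) * (b - a).
  apply: (@MVT_is_derive (Re \o (fun t => D^* * u t)) (fun t => Re (D^* * v t))) => // t /uv uvt.
  exact/rder_Re/derZ.
rewrite -cReB -mulrBr -/D.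
have -> : Re (D^* * D) = cmod D * cmod D.
  by rewrite -expr2 cmodE sqr_sqrtr ?addr_ge0 ?sqr_ge0 // cReM cRe_conj cIm_conj
    mulNr opprK -!expr2.
have [->|D0] := eqVneq D 0.
  move=> _; rewrite cmod0 mulr_ge0 ?subr_ge0 // (le_trans (cmod_ge0 (v c))) //.
  exact: vM.
move=> E; have : cmod D * cmod D <= cmod D * (M * (b - a)).
  rewrite E mulrA ler_wpM2r ?subr_ge0 // (le_trans (ler_norm _)) //.
  rewrite (le_trans (cmod_Re _)) // cmodM cmod_conj ler_wpM2l ?cmod_ge0 //.
  exact: vM.
by rewrite ler_pM2l // cmod_gt0.
Qed.

Definition rcont u t := forall e : R, 0 < e -> exists2 d : R, 0 < d &
  forall s, `|s - t| < d -> cmod (u s - u t) <= e.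

Lemma continuous_at_eps (f : R -> R) t : {for t, continuous f} <->
  forall e : R, 0 < e -> exists2 d : R, 0 < d &
    forall s, `|s - t| < d -> `|f s - f t| <= e.
Proof.
split=> [/cvgrPdist_le h e /h /nbhs_ballP[d /= d0 {}h]|h].
  by exists d => // s sd; rewrite distrC; apply: h; rewrite /ball /= distrC.
apply/cvgrPdist_le => e /h[d d0 {}h]; apply/nbhs_ballP; exists d => // s.
by rewrite /ball /= distrC => /h; rewrite distrC.
Qed.

Lemma rcontP u t : rcont u t <->
  {for t, continuous (Re \o u)} /\ {for t, continuous (Im \o u)}.
Proof.
rewrite !continuous_at_eps; split=> [h|[h1 h2] e e0].
  split=> e /h[d d0 {}h]; exists d => // s /h; apply: le_trans;
    rewrite /= -?cReB -?cImB ?cmod_Re ?cmod_Im //.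
have e20 : 0 < e / 2 by rewrite divr_gt0.
have [d1 d10 {}h1] := h1 _ e20; have [d2 d20 {}h2] := h2 _ e20.
exists (Num.min d1 d2) => [|s]; first by rewrite lt_min d10.
rewrite lt_min => /andP[/h1 l1 /h2 l2].
by rewrite (le_trans (cmod_le _)) // [e]splitr cReB cImB lerD.
Qed.

(** The primitive is an integral starting at [a], so it is differentiated only to the right of [a];
    later uses place [a] at or before the left end of the range they need. *)
Lemma continuous_antiderivative (f : R -> R) a : continuous f ->
  exists F : R -> R, forall t, a < t -> is_derive t 1 F (f t).
Proof.
move=> cf; exists (fun x => \int[lebesgue_measure]_(t in [set` `[a, x]]) f t).
move=> t at_; have [||F1 F2] := @continuous_FTC1_closed R f a t (t + 1) _ _ at_ (cf t).
- by rewrite ltrDl.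
- apply: continuous_compact_integrable; first exact: segment_compact.
  exact: continuous_subspaceT.
by split; [exact: F1|rewrite -derive1E; exact: F2].
Qed.

Lemma rcont_antiderivative u a : (forall t, rcont u t) ->
  exists U : R -> C, forall t, a < t -> rder U t (u t).
Proof.
move=> cu.
have [F1 h1] := @continuous_antiderivative (Re \o u) a (fun t => (proj1 (rcontP u t) (cu t)).1).
have [F2 h2] := @continuous_antiderivative (Im \o u) a (fun t => (proj1 (rcontP u t) (cu t)).2).
exists (fun t => (F1 t +i* F2 t)%C) => t /[dup] /h1 {}h1 /h2 {}h2.
exact/rder_is_derive.
Qed.

End RealVariable.

(** * Goursat's theorem and local primitives *)

Section Goursat.
Variable R : realType.
Notation C := (Cplx R).

Definition ccont (f : C -> C) (z : C) := forall e : R, 0 < e ->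
  exists2 d : R, 0 < d & forall w, cmod (w - z) < d -> cmod (f w - f z) <= e.

Lemma cder_ccont f z v : cder f z v -> ccont f z.
Proof.
move=> fv e e0; have [d d0 h] := der_cont fv e0.
by exists d => // w /h; exact: ltW.
Qed.

Definition pt (x y : R) : C := (x +i* y)%C.

Lemma ptE x y : pt x y = rc x + ii * rc y.
Proof. exact: complexRI. Qed.

Lemma ptB x y x' y' : cmod (pt x y - pt x' y') <= `|x - x'| + `|y - y'|.
Proof. exact: cmod_le. Qed.

Lemma rder_hline (y s : R) : rder (pt ^~ y) s 1.
Proof.
have := derD (der_id (@rc R) s) (der_cst (@rc R) (ii * rc y) s).
rewrite addr0; apply: der_ext => t; exact/esym/ptE.
Qed.

Lemma rder_vline (x s : R) : rder (pt x) s ii.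
Proof.
have := derD (der_cst (@rc R) (rc x) s) (derZ ii (der_id (@rc R) s)).
rewrite add0r mulr1; apply: der_ext => t; exact/esym/ptE.
Qed.

Lemma rder_le_sym u (v : R -> C) (a b M : R) :
  (forall t, Num.min a b <= t <= Num.max a b -> rder u t (v t)) ->
  (forall t, Num.min a b <= t <= Num.max a b -> cmod (v t) <= M) ->
  cmod (u b - u a) <= M * `|b - a|.
Proof.
have [ab|/ltW ab] := leP a b => uv vM.
  by rewrite ger0_norm ?subr_ge0 //; exact: rder_le uv vM.
by rewrite distrC ger0_norm ?subr_ge0 // cmod_distC; exact: rder_le uv vM.
Qed.

(** The point is the supremum of the left ends, none of which exceeds a right end. *)
Lemma nested_interval (a : nat -> R) (w : R) : 0 <= w ->
  (forall n, a n <= a n.+1) ->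
  (forall n, a n.+1 + w / 2 ^+ n.+1 <= a n + w / 2 ^+ n) ->
  exists x, forall n, a n <= x <= a n + w / 2 ^+ n.
Proof.
move=> w0 a1 a2.
have wn n : 0 <= w / 2 ^+ n by rewrite divr_ge0 // exprn_ge0.
have m1 : {homo a : n m / (n <= m)%N >-> n <= m}.
  by apply: homo_leq a1 => //; exact: le_trans.
have m2 n m : (n <= m)%N -> a m + w / 2 ^+ m <= a n + w / 2 ^+ n.
  elim: m => [|m IH]; first by rewrite leqn0 => /eqP ->.
  rewrite leq_eqVlt => /orP[/eqP ->//|/IH]; exact: le_trans.
have am n m : a n <= a m + w / 2 ^+ m.
  have [nm|/ltnW mn] := leqP n m.
    by rewrite (le_trans (m1 _ _ nm)) // lerDl.
  by rewrite (le_trans _ (m2 _ _ mn)) // lerDl.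
have hs : has_sup (range a).
  by split; [exists (a 0), 0|exists (a 0 + w / 2 ^+ 0) => _ [n _ <-]].
exists (sup (range a)) => n; apply/andP; split.
  by apply: ub_le_sup; [exact: hs.2|exists n].
by apply: ge_sup; [exact: hs.1|move=> _ [k _ <-]].
Qed.

Lemma lt_half_pow (L d : R) : 0 <= L -> 0 < d -> exists n, L / 2 ^+ n < d.
Proof.
move=> L0 d0; exists (Num.bound (L / d)).
rewrite ltr_pdivrMr ?exprn_gt0 // mulrC -ltr_pdivrMr //.
apply: lt_le_trans (archi_boundP (divr_ge0 L0 (ltW d0))) _.
by rewrite -natrX ler_nat ltnW // ltn_expl.
Qed.

Section Rectangle.
Variables (f : C -> C) (x0 y0 : R) (A B : R -> R -> C).
Hypothesis hA : forall y s, x0 < s -> rder (A y) s (f (pt s y)).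
Hypothesis hB : forall x t, y0 < t -> rder (B x) t (f (pt x t)).

(* [A y] and [B x] are primitives of [f] along horizontal and vertical lines,
   so that this is the integral of [f] along the boundary of a rectangle. *)
Definition rectI x1 x2 y1 y2 : C :=
  (A y1 x2 - A y1 x1) + ii * (B x2 y2 - B x2 y1) -
  (A y2 x2 - A y2 x1) - ii * (B x1 y2 - B x1 y1).

(** The affine function has the quadratic primitive [Q] on the whole plane, so it contributes
    nothing around the rectangle. Along each side the difference of the two primitives has
    derivative at most [e], and the factor of [e] is the perimeter. *)
Lemma rectI_affine (al be : C) x1 x2 y1 y2 e :
  x0 < x1 -> x1 <= x2 -> y0 < y1 -> y1 <= y2 ->
  (forall x y, x1 <= x <= x2 -> y1 <= y <= y2 ->
    cmod (f (pt x y) - (al + be * pt x y)) <= e) ->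
  cmod (rectI x1 x2 y1 y2) <= e * (2 * ((x2 - x1) + (y2 - y1))).
Proof.
move=> h1 h2 h3 h4 he.
pose Q (z : C) : C := al * z + be / 2 * (z * z).
have dQ z : cder Q z (al + be * z).
  have := derD (derZ al (der_id id z)) (derZ (be / 2) (derM (der_id id z) (der_id id z))).
  by rewrite (_ : al * 1 + _ = al + be * z) //; field.
have dA y : y1 <= y <= y2 ->
    cmod ((A y x2 - Q (pt x2 y)) - (A y x1 - Q (pt x1 y))) <= e * (x2 - x1).
  move=> yy; apply: (@rder_le _ (fun s => A y s - Q (pt s y))
    (fun s => f (pt s y) - (al + be * pt s y) * 1)) => // s ss.
    apply: derB; last exact: (der_comp (rder_hline y s) (dQ _)).
    by apply: hA; rewrite (lt_le_trans h1) //; case/andP: ss.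
  by rewrite mulr1 he.
have dB x : x1 <= x <= x2 ->
    cmod ((ii * B x y2 - Q (pt x y2)) - (ii * B x y1 - Q (pt x y1))) <= e * (y2 - y1).
  move=> xx; apply: (@rder_le _ (fun s => ii * B x s - Q (pt x s))
    (fun s => ii * f (pt x s) - (al + be * pt x s) * ii)) => // s ss.
    apply: derB; last exact: (der_comp (rder_vline x s) (dQ _)).
    by apply/derZ/hB; rewrite (lt_le_trans h3) //; case/andP: ss.
  by rewrite [_ * ii]mulrC -mulrBr cmodM cmod_ii mul1r he.
have -> : rectI x1 x2 y1 y2 =
  ((A y1 x2 - Q (pt x2 y1)) - (A y1 x1 - Q (pt x1 y1)) +
   ((ii * B x2 y2 - Q (pt x2 y2)) - (ii * B x2 y1 - Q (pt x2 y1)))) -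
  ((A y2 x2 - Q (pt x2 y2)) - (A y2 x1 - Q (pt x1 y2)) +
   ((ii * B x1 y2 - Q (pt x1 y2)) - (ii * B x1 y1 - Q (pt x1 y1)))).
  by rewrite /rectI; ring.
have -> : e * (2 * (x2 - x1 + (y2 - y1))) =
  (e * (x2 - x1) + e * (y2 - y1)) + (e * (x2 - x1) + e * (y2 - y1)) by ring.
rewrite (le_trans (cmodB _ _)) // lerD // (le_trans (cmodD _ _)) // lerD //;
  by rewrite ?dA ?dB // ?h2 ?h4 ?lexx.
Qed.

(** If the integral exceeded k L^2, that of one quarter would exceed k (L / 2)^2, and so on. At the
    common point of the nested rectangles the affine approximation of [f] contradicts this; [k]
    being arbitrary, the integral is 0. *)
Lemma goursat x1 x2 y1 y2 : x0 < x1 -> x1 <= x2 -> y0 < y1 -> y1 <= y2 ->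
  (forall x y, x1 <= x <= x2 -> y1 <= y <= y2 -> exists v, cder f (pt x y) v) ->
  rectI x1 x2 y1 y2 = 0.
Proof.
move=> h1 h2 h3 h4 hf; set W := x2 - x1; set H := y2 - y1; set L := W + H.
have W0 : 0 <= W by rewrite subr_ge0.
have H0 : 0 <= H by rewrite subr_ge0.
have L0 : 0 <= L by rewrite addr_ge0.
suff main (k : R) : 0 < k -> cmod (rectI x1 x2 y1 y2) <= k * L ^+ 2.
  apply: cmod_le_eps => e e0.
  have L1 : 0 < L ^+ 2 + 1 by rewrite ltr_wpDl // sqr_ge0.
  rewrite (le_trans (main _ (divr_gt0 e0 L1))) // mulrAC ler_pdivrMr //.
  by rewrite ler_wpM2l ?(ltW e0) // lerDl.
move=> k0; rewrite leNgt; apply/negP => kL.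
pose bad n (p : R * R) := [/\ x1 <= p.1, p.1 + W / 2 ^+ n <= x2, y1 <= p.2,
  p.2 + H / 2 ^+ n <= y2 & k * (L / 2 ^+ n) ^+ 2 <
  cmod (rectI p.1 (p.1 + W / 2 ^+ n) p.2 (p.2 + H / 2 ^+ n))].
(* The hypothesis of badness stays under the existential, so that [choice] produces a total
   successor function. *)
have step (np : nat * (R * R)) : exists q : R * R, bad np.1 np.2 ->
  bad np.1.+1 q /\ [/\ np.2.1 <= q.1, q.1 + W / 2 ^+ np.1.+1 <= np.2.1 + W / 2 ^+ np.1,
    np.2.2 <= q.2 & q.2 + H / 2 ^+ np.1.+1 <= np.2.2 + H / 2 ^+ np.1].
  case: np => n [x y] /=.
  have [hb|nb] := pselect (bad n (x, y)); last by exists (0, 0).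
  case: hb => /= b1 b2 b3 b4 b5.
  have half (D : R) : D / 2 ^+ n = D / 2 ^+ n.+1 + D / 2 ^+ n.+1.
    by rewrite exprS; field; rewrite expf_neq0.
  have w0 : 0 <= W / 2 ^+ n.+1 by rewrite divr_ge0 // exprn_ge0.
  have H1 : 0 <= H / 2 ^+ n.+1 by rewrite divr_ge0 // exprn_ge0.
  move: b2 b4 b5; rewrite /bad /= !half.
  move: (W / 2 ^+ n.+1) (H / 2 ^+ n.+1) (L / 2 ^+ n.+1) w0 H1 => w g l w0 g0 b2 b4 b5.
  have : exists q, [/\ q.1 = x \/ q.1 = x + w, q.2 = y \/ q.2 = y + g &
      k * l ^+ 2 < cmod (rectI q.1 (q.1 + w) q.2 (q.2 + g))].
    apply: contrapT => hn.
    have small q1 q2 : q1 = x \/ q1 = x + w -> q2 = y \/ q2 = y + g ->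
        cmod (rectI q1 (q1 + w) q2 (q2 + g)) <= k * l ^+ 2.
      move=> e1 e2; rewrite leNgt; apply/negP => lt.
      by apply: hn; exists (q1, q2).
    have s1 := small x y (or_introl erefl) (or_introl erefl).
    have s2 := small (x + w) y (or_intror erefl) (or_introl erefl).
    have s3 := small x (y + g) (or_introl erefl) (or_intror erefl).
    have s4 := small (x + w) (y + g) (or_intror erefl) (or_intror erefl).
    move: b5; apply/negP; rewrite -leNgt.
    have -> : rectI x (x + (w + w)) y (y + (g + g)) =
      (rectI x (x + w) y (y + g) + rectI (x + w) (x + w + w) y (y + g)) +
      (rectI x (x + w) (y + g) (y + g + g) +
       rectI (x + w) (x + w + w) (y + g) (y + g + g)).
      by rewrite !addrA /rectI; ring.
    have -> : k * (l + l) ^+ 2 = (k * l ^+ 2 + k * l ^+ 2) + (k * l ^+ 2 + k * l ^+ 2).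
      by ring.
    by rewrite (le_trans (cmodD _ _)) // lerD // (le_trans (cmodD _ _)) // lerD.
  case=> -[q1 q2] /= [e1 e2 lt]; exists (q1, q2) => /= _.
  by case: e1 e2 lt => ? [] ?; subst q1 q2 => lt; split; split => //=; lra.
have [g hg] := choice step.
pose p := fix p n := if n is m.+1 then g (m, p m) else (x1, y1).
have pbad n : bad n (p n).
  elim: n => [|n IH]; last exact: (hg (n, p n) IH).1.
  have eW : x1 + W = x2 by rewrite addrC subrK.
  have eH : y1 + H = y2 by rewrite addrC subrK.
  by split; rewrite /= ?expr0 ?divr1 ?eW ?eH.
have pstep n := (hg (n, p n) (pbad n)).2.
have [X hX] : exists x, forall n, (p n).1 <= x <= (p n).1 + W / 2 ^+ n.
  by apply: nested_interval => // n; have [] := pstep n.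
have [Y hY] : exists y, forall n, (p n).2 <= y <= (p n).2 + H / 2 ^+ n.
  by apply: nested_interval => // n; have [] := pstep n.
have [v fv] : exists v, cder f (pt X Y) v.
  apply: hf.
    have [b1 b2 _ _ _] := pbad 0; have /andP[c1 c2] := hX 0.
    by rewrite (le_trans b1 c1) (le_trans c2 b2).
  have [_ _ b1 b2 _] := pbad 0; have /andP[c1 c2] := hY 0.
  by rewrite (le_trans b1 c1) (le_trans c2 b2).
(* With l = L / 2^n, the n-th rectangle lies within l of the limit point and has perimeter 2 l. An
   affine error of (k / 2) l therefore bounds its integral by k l^2. *)
have k20 : 0 < k / 2 by rewrite divr_gt0.
have [d d0 hd] := fv _ k20.
have [n nd] := lt_half_pow L0 d0.
have [b1 b2 b3 b4] := pbad n; apply/negP; rewrite -leNgt.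
have LE : L / 2 ^+ n = W / 2 ^+ n + H / 2 ^+ n by rewrite mulrDl.
have w0 : 0 <= W / 2 ^+ n by rewrite divr_ge0 // exprn_ge0.
have H1 : 0 <= H / 2 ^+ n by rewrite divr_ge0 // exprn_ge0.
move: (hX n) (hY n) => hXn hYn.
rewrite (le_trans (@rectI_affine (f (pt X Y) - v * pt X Y) v _ _ _ _
   (k / 2 * (L / 2 ^+ n)) _ _ _ _ _)) ?lerDl //.
- exact: lt_le_trans b1.
- exact: lt_le_trans b3.
- move=> x y xx yy.
  have le : cmod (pt x y - pt X Y) <= L / 2 ^+ n.
    rewrite (le_trans (ptB _ _ _ _)) // LE lerD // ler_norml;
      [move: xx hXn|move: yy hYn]; move: (_ / _) => t; lra.
  have -> : f (pt x y) - (f (pt X Y) - v * pt X Y + v * pt x y) =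
    f (pt x y) - f (pt X Y) - v * (pt x y - pt X Y) by ring.
  rewrite (le_trans (hd _ (le_lt_trans le nd))) // ler_wpM2l // ltW //.
rewrite !(addrC _ (_ / 2 ^+ n)) !addrK -LE.
by move: (L / 2 ^+ n) => l; rewrite (_ : k / 2 * l * (2 * l) = k * l ^+ 2) //; field.
Qed.

Lemma rectI_hcat x1 a x2 y1 y2 :
  rectI x1 x2 y1 y2 = rectI x1 a y1 y2 + rectI a x2 y1 y2.
Proof. by rewrite /rectI; ring. Qed.

Lemma rectI_vcat x1 x2 y1 b y2 :
  rectI x1 x2 y1 y2 = rectI x1 x2 y1 b + rectI x1 x2 b y2.
Proof. by rewrite /rectI; ring. Qed.

(** Four outer rectangles avoiding [p] are removed by [goursat]. What remains is a small rectangle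
    around [p], on which [f] is bounded by continuity at [p], so that its integral is as small as
    desired. *)
Lemma goursat_except (p : C) x1 x2 y1 y2 :
  x0 < x1 -> x1 <= x2 -> y0 < y1 -> y1 <= y2 -> ccont f p ->
  (forall x y, x1 <= x <= x2 -> y1 <= y <= y2 -> pt x y <> p ->
    exists v, cder f (pt x y) v) ->
  rectI x1 x2 y1 y2 = 0.
Proof.
move=> h1 h2 h3 h4 cf hf.
have [pin|pout] := boolP ((x1 <= Re p <= x2) && (y1 <= Im p <= y2)); last first.
  apply: goursat => // x y xx yy; apply: hf => // E.
  by move: pout; rewrite -E /= xx yy.
case/andP: pin => /andP[px1 px2] /andP[py1 py2].
apply: cmod_le_eps => e e0.
have [d d0 hd] := cf 1 ltr01; set M := cmod (f p) + 1.
have M0 : 0 < M by rewrite ltr_wpDl ?cmod_ge0.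
(* Points of the central rectangle are at distance at most 2 s < d from [p], so |f| <= M there, and
   its perimeter is at most 8 s. *)
pose s := Num.min (d / 4) (e / (8 * M)).
have s0 : 0 < s by rewrite lt_min !divr_gt0 // mulr_gt0.
have sd : s <= d / 4 by rewrite ge_min lexx.
have se : 8 * M * s <= e.
  by rewrite mulrC -ler_pdivlMr ?mulr_gt0 // ge_min lexx orbT.
pose a1 := Num.max x1 (Re p - s); pose a2 := Num.min x2 (Re p + s).
pose b1 := Num.max y1 (Im p - s); pose b2 := Num.min y2 (Im p + s).
have [A1 A2 A3] : [/\ x1 <= a1, a1 <= Re p & Re p - s <= a1].
  by rewrite /a1; split; rewrite ?le_max ?ge_max ?lexx ?px1 ?orbT //= lerBlDr lerDl ltW.
have [A4 A5 A6] : [/\ a2 <= x2, Re p <= a2 & a2 <= Re p + s].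
  by rewrite /a2; split; rewrite ?le_min ?ge_min ?lexx ?px2 ?orbT //= lerDl ltW.
have [B1 B2 B3] : [/\ y1 <= b1, b1 <= Im p & Im p - s <= b1].
  by rewrite /b1; split; rewrite ?le_max ?ge_max ?lexx ?py1 ?orbT //= lerBlDr lerDl ltW.
have [B4 B5 B6] : [/\ b2 <= y2, Im p <= b2 & b2 <= Im p + s].
  by rewrite /b2; split; rewrite ?le_min ?ge_min ?lexx ?py2 ?orbT //= lerDl ltW.
(* [p] may lie on a side of the rectangle: each outer piece is then either degenerate or free of
   [p]. *)
have C1 : a1 = x1 \/ a1 < Re p.
  by rewrite /a1; case: (leP x1 (Re p - s)) => _; [right; rewrite ltrBlDr ltrDl|left].
have C2 : a2 = x2 \/ Re p < a2.
  by rewrite /a2; case: (leP x2 (Re p + s)) => _; [left|right; rewrite ltrDl].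
have D1 : b1 = y1 \/ b1 < Im p.
  by rewrite /b1; case: (leP y1 (Im p - s)) => _; [right; rewrite ltrBlDr ltrDl|left].
have D2 : b2 = y2 \/ Im p < b2.
  by rewrite /b2; case: (leP y2 (Im p + s)) => _; [left|right; rewrite ltrDl].
move: a1 a2 b1 b2 A1 A2 A3 A4 A5 A6 B1 B2 B3 B4 B5 B6 C1 C2 D1 D2.
move=> a1 a2 b1 b2 A1 A2 A3 A4 A5 A6 B1 B2 B3 B4 B5 B6 C1 C2 D1 D2.
have R1 : rectI x1 a1 y1 y2 = 0.
  case: C1 => [->|lt]; first by rewrite /rectI; ring.
  apply: goursat => // x y /andP[u1 u2] u3; apply: hf => //.
    by rewrite u1 /=; lra.
  by move=> E; move: lt u2; rewrite -E /=; lra.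
have R2 : rectI a2 x2 y1 y2 = 0.
  case: C2 => [->|lt]; first by rewrite /rectI; ring.
  apply: goursat => //; first lra.
  move=> x y /andP[u1 u2] u3; apply: hf => //; first by rewrite u2 andbT; lra.
  by move=> E; move: lt u1; rewrite -E /=; lra.
have R3 : rectI a1 a2 y1 b1 = 0.
  case: D1 => [->|lt]; first by rewrite /rectI; ring.
  apply: goursat => //; try lra.
  move=> x y /andP[u1 u2] /andP[u3 u4]; apply: hf; try (apply/andP; lra).
  by move=> E; move: lt u4; rewrite -E /=; lra.
have R4 : rectI a1 a2 b2 y2 = 0.
  case: D2 => [->|lt]; first by rewrite /rectI; ring.
  apply: goursat => //; try lra.
  move=> x y /andP[u1 u2] /andP[u3 u4]; apply: hf; try (apply/andP; lra).
  by move=> E; move: lt u3; rewrite -E /=; lra.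
rewrite (rectI_hcat _ a1) R1 add0r (rectI_hcat _ a2) R2 addr0.
rewrite (rectI_vcat _ _ _ b1) R3 add0r (rectI_vcat _ _ _ b2) R4 addr0.
apply: le_trans se; rewrite (le_trans (@rectI_affine 0 0 _ _ _ _ M _ _ _ _ _)) //;
  try lra.
  move=> x y /andP[u1 u2] /andP[u3 u4]; rewrite mul0r addr0 subr0.
  rewrite -(subrK (f p) (f _)) (le_trans (cmodD _ _)) // addrC lerD2l hd //.
  rewrite {1}[p]complexRI -ptE (le_lt_trans (ptB _ _ _ _)) //.
  have n1 : `|x - Re p| <= s by rewrite ler_norml; lra.
  have n2 : `|y - Im p| <= s by rewrite ler_norml; lra.
  by move: n1 n2; move: (`|_|) (`|_|) => n1 n2; lra.
have -> : 8 * M * s = M * (8 * s) by ring.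
by rewrite ler_pM2l //; lra.
Qed.

End Rectangle.

Definition square (c : C) (r : R) (z : C) : Prop :=
  `|Re z - Re c| < r /\ `|Im z - Im c| < r.

(** The primitive integrates [f] from [c] horizontally, then vertically. Continuity on the whole
    plane provides antiderivatives along all these lines; [local_primitive] then localizes the
    hypothesis. *)
Lemma primitive_square (f : C -> C) (c p : C) (r : R) : 0 < r ->
  (forall z, ccont f z) ->
  (forall z, square c r z -> z <> p -> exists v, cder f z v) ->
  exists F, forall z, square c r z -> cder F z (f z).
Proof.
move=> r0 cf hf.
have [|A hA] := @choice _ _ (fun y (a : R -> C) =>
    forall s, Re c - r < s -> rder a s (f (pt s y))).
  move=> y; apply: (rcont_antiderivative (u := fun s => f (pt s y))).
  move=> t e /(cf (pt t y))[d d0 hd]; exists d => // s sd.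
  apply: hd; rewrite (le_lt_trans (ptB _ _ _ _)) // subrr normr0 addr0 //.
have [|B hB] := @choice _ _ (fun x (b : R -> C) =>
    forall s, Im c - r < s -> rder b s (f (pt x s))).
  move=> x; apply: (rcont_antiderivative (u := fun s => f (pt x s))).
  move=> t e /(cf (pt x t))[d d0 hd]; exists d => // s sd.
  apply: hd; rewrite (le_lt_trans (ptB _ _ _ _)) // subrr normr0 add0r //.
have rect0 x1 x2 y1 y2 : `|x1 - Re c| < r -> `|x2 - Re c| < r ->
    `|y1 - Im c| < r -> `|y2 - Im c| < r -> rectI A B x1 x2 y1 y2 = 0.
  move=> h1 h2 h3 h4.
  wlog x12 : x1 x2 h1 h2 / x1 <= x2.
    move=> W; have [/W->//|/ltW/W h] := leP x1 x2.
    by apply: oppr_inj; rewrite oppr0 -h // /rectI; ring.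
  wlog y12 : y1 y2 h3 h4 / y1 <= y2.
    move=> W; have [/W->//|/ltW/W h] := leP y1 y2.
    by apply: oppr_inj; rewrite oppr0 -h // /rectI; ring.
  move: h1 h2 h3 h4; rewrite !ltr_norml => h1 h2 h3 h4.
  apply: (goursat_except hA hB _ x12 _ y12 (cf p)); try lra.
  by move=> x y xx yy; apply: hf; split; rewrite /= ltr_norml; lra.
exists (fun z => (A (Im c) (Re z) - A (Im c) (Re c)) +
    ii * (B (Re z) (Im z) - B (Re z) (Im c))) => z [zx zy] e e0.
have e20 : 0 < e / 2 by rewrite divr_gt0.
have [d d0 hd] := cf z _ e20.
pose d' := Num.min (d / 2) (Num.min (r - `|Re z - Re c|) (r - `|Im z - Im c|)).
have d'0 : 0 < d' by rewrite !lt_min divr_gt0 // !subr_gt0 zx zy.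
exists d' => // w; rewrite !lt_min => /and3P[wd wx wy].
have lx := cmod_Re (w - z); have ly := cmod_Im (w - z).
move: lx ly; rewrite cReB cImB => lx ly.
set x := Re z; set x' := Re w; set y := Im z; set y' := Im w.
set D := cmod (w - z) in wd wx wy lx ly *.
have zE : z = pt x y by rewrite ptE -complexRI.
have x'c : `|x' - Re c| < r.
  by rewrite (le_lt_trans (ler_distD (Re z) _ _)) //; move: lx wx;
  rewrite -/x'; move: (`|_|) (`|_|) => n1 n2; lra.
have y'c : `|y' - Im c| < r.
  by rewrite (le_lt_trans (ler_distD (Im z) _ _)) //; move: ly wy;
  rewrite -/y'; move: (`|_|) (`|_|) => n1 n2; lra.
(* As the rectangle between the heights Im c and y contributes 0, the increment from z to w may be
   computed along the horizontal at height y followed by the vertical at abscissa x'; both stay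
   close to z. *)
have -> : A (Im c) x' - A (Im c) (Re c) + ii * (B x' y' - B x' (Im c)) -
    (A (Im c) x - A (Im c) (Re c) + ii * (B x y - B x (Im c))) - f z * (w - z) =
  ((A y x' - f z * rc x') - (A y x - f z * rc x)) +
  ii * ((B x' y' - f z * rc y') - (B x' y - f z * rc y)).
  have := rect0 x x' (Im c) y zx x'c; rewrite subrr normr0 => /(_ r0 zy).
  have -> : w - z = (rc x' - rc x) + ii * (rc y' - rc y).
    by rewrite [w]complexRI {1}zE ptE -/x' -/y'; ring.
  rewrite /rectI => E.
  apply/eqP; rewrite -subr_eq0 -[X in _ == X]E; apply/eqP; ring.
have between (a b t : R) : Num.min a b <= t <= Num.max a b -> `|t - a| <= `|b - a|.
  have [ab|ab] := leP a b => /andP[u1 u2].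
    by rewrite !ger0_norm; lra.
  by rewrite !ler0_norm; lra.
rewrite [e]splitr mulrDl (le_trans (cmodD _ _)) // lerD // ?cmodM ?cmod_ii ?mul1r.
  rewrite (le_trans (@rder_le_sym (fun s => A y s - f z * rc s)
    (fun s => f (pt s y) - f z * 1) x x' (e / 2) _ _)) //.
  - move=> t /between tx; apply: derB; last exact/derZ/der_id.
    apply: hA; have : `|t - Re c| < r.
      by rewrite (le_lt_trans (ler_distD (Re z) _ _)) //; move: tx lx wx;
        rewrite -/x'; move: (`|_|) (`|_|) (`|_|) => n1 n2 n3; lra.
    by rewrite ltr_norml; lra.
  - move=> t /between tx; rewrite mulr1 hd // zE (le_lt_trans (ptB _ _ _ _)) //.
    rewrite subrr normr0 addr0; move: tx lx wd; rewrite -/x' -/x.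
    by move: (`|_|) (`|_|) => n1 n2; lra.
  by rewrite ler_wpM2l // ltW.
rewrite (le_trans (@rder_le_sym (fun s => B x' s - f z * rc s)
    (fun s => f (pt x' s) - f z * 1) y y' (e / 2) _ _)) //.
- move=> t /between tx; apply: derB; last exact/derZ/der_id.
  apply: hB; have : `|t - Im c| < r.
    by rewrite (le_lt_trans (ler_distD (Im z) _ _)) //; move: tx ly wy;
      rewrite -/y'; move: (`|_|) (`|_|) (`|_|) => n1 n2 n3; lra.
  by rewrite ltr_norml; lra.
- move=> t /between tx; rewrite mulr1 hd // zE (le_lt_trans (ptB _ _ _ _)) //.
  move: tx lx ly wd; rewrite -/x' -/x -/y -/y'.
  by move: (`|_|) (`|_|) (`|_|) => n1 n2 n3; lra.
by rewrite ler_wpM2l // ltW.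
Qed.

Definition clampR (a b t : R) := Num.max a (Num.min b t).

Lemma clampR_in a b t : a <= b -> a <= clampR a b t <= b.
Proof. by move=> ab; rewrite /clampR le_max lexx ge_max ab ge_min lexx. Qed.

Lemma clampR_id a b t : a <= t <= b -> clampR a b t = t.
Proof.
by move=> /andP[at_ tb]; rewrite /clampR min_r // max_r.
Qed.

Lemma clampR_lip a b s t : a <= b -> `|clampR a b s - clampR a b t| <= `|s - t|.
Proof.
move=> ab; have := ler_norm (s - t); have := ler_norm (t - s).
rewrite (distrC t s) ler_norml /clampR; move: (`|_|) => n.
case: (leP b s) => h1; case: (leP b t) => h2; rewrite ?(max_r ab);
  do ?[case: (leP a s) => h3]; do ?[case: (leP a t) => h4]; lra.
Qed.

(** Composing [f] with the retraction [K] onto the square of half-side d / 3 makes it continuous on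
    the whole plane and leaves it unchanged inside the square. Points of that square are within 2 d
    / 3 of [c]. *)
Lemma local_primitive (f : C -> C) (c p : C) (d : R) : 0 < d ->
  (forall z, cmod (z - c) < d -> ccont f z) ->
  (forall z, cmod (z - c) < d -> z <> p -> exists v, cder f z v) ->
  exists F, forall z, square c (d / 3) z -> cder F z (f z).
Proof.
move=> d0 cf hf; pose r := d / 3; have r0 : 0 < r by rewrite divr_gt0.
pose cl (a t : R) := clampR (a - r) (a + r) t.
have ar (a : R) : a - r <= a + r by lra.
pose K (z : C) := pt (cl (Re c) (Re z)) (cl (Im c) (Im z)).
have Kc z : cmod (K z - c) < d.
  rewrite [c in X in X < _]complexRI -ptE (le_lt_trans (ptB _ _ _ _)) //.
  have n1 : `|cl (Re c) (Re z) - Re c| <= r.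
    by rewrite ler_norml; have := clampR_in (Re z) (ar (Re c)); rewrite /cl; lra.
  have n2 : `|cl (Im c) (Im z) - Im c| <= r.
    by rewrite ler_norml; have := clampR_in (Im z) (ar (Im c)); rewrite /cl; lra.
  by rewrite (le_lt_trans (lerD n1 n2)) // /r; lra.
have Kid z : square c r z -> K z = z.
  move=> []; rewrite !ltr_norml => h1 h2; apply: complexP => /=;
  by rewrite /cl clampR_id //; lra.
have Ksq z : square c r z -> exists2 d' : R, 0 < d' & forall w, cmod (w - z) < d' -> square c r w.
  move=> [h1 h2]; exists (Num.min (r - `|Re z - Re c|) (r - `|Im z - Im c|)).
    by rewrite lt_min !subr_gt0 h1.
  move=> w; rewrite lt_min => /andP[w1 w2].
  have := cmod_Re (w - z); have := cmod_Im (w - z); rewrite cReB cImB => l1 l2.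
  split; [apply: le_lt_trans (ler_distD (Re z) _ _) _|
          apply: le_lt_trans (ler_distD (Im z) _ _) _];
    move: l1 l2 w1 w2; move: (`|_|) (`|_|) (`|_|) (`|_|) => n1 n2 n3 n4; lra.
have [F hF] : exists F, forall z, square c r z -> cder F z ((f \o K) z).
  apply: (@primitive_square _ c p) => // z.
    move=> e e0; have [d1 d10 h] := cf _ (Kc z) e e0.
    exists (d1 / 2) => [|w wd]; first by rewrite divr_gt0.
    apply: h; rewrite (le_lt_trans (ptB _ _ _ _)) //.
    rewrite (le_lt_trans (lerD (clampR_lip _ _ (ar _)) (clampR_lip _ _ (ar _)))) //.
    have := cmod_Re (w - z); have := cmod_Im (w - z); rewrite cReB cImB.
    by move: wd; move: (`|_|) (`|_|) => n1 n2; lra.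
  move=> zs zp.
  have [v fv] : exists v, cder f z v by apply: hf => //; rewrite -[in z - c](Kid z).
  have [d1 d10 h1] := Ksq _ zs.
  by exists v; apply: der_eps d10 _ fv => w /h1 /Kid /= ->.
by exists F => z zs; have := hF z zs; rewrite /= Kid.
Qed.

End Goursat.

(** * Maximum principle and Cauchy formula *)

Section Circle.
Variable R : realType.
Notation C := (Cplx R).

Definition circle (c u : C) (t : R) : C := c + u * pt (cos t) (sin t).

Lemma rder_circle (c u : C) (t : R) : rder (circle c u) t (ii * (circle c u t - c)).
Proof.
have : rder (fun t : R => pt (cos t) (sin t)) t (pt (- sin t) (cos t)).
  apply/rder_is_derive; split => /=; [exact: is_derive_cos|exact: is_derive_sin].
move=> /(derZ u)/(derD (der_cst (@rc R) c t)); rewrite add0r.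
rewrite (_ : u * pt _ _ = ii * (circle c u t - c)) //.
rewrite /circle addrC addKr mulrCA; congr (_ * _).
by apply: complexP; rewrite /= !(mul0r, mul1r, sub0r, add0r, addr0).
Qed.

Lemma circle_2pi c u : circle c u (pi *+ 2) = circle c u 0.
Proof. by rewrite /circle cos2pi sin2pi cos0 sin0. Qed.

Lemma circleN2pi c u : circle c u (- (pi *+ 2)) = circle c u 0.
Proof. by rewrite /circle cosN sinN cos2pi sin2pi cos0 sin0 oppr0. Qed.

Lemma circle0 c u : circle c u 0 = c + u.
Proof.
by rewrite /circle cos0 sin0 (_ : pt 1 0 = 1) // mulr1.
Qed.

Lemma cmod_circle c u t : cmod (circle c u t - c) = cmod u.
Proof.
rewrite /circle addrC addKr cmodM (_ : cmod (pt _ _) = 1) ?mulr1 //.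
by rewrite cmodE /= cos2Dsin2 sqrtr1.
Qed.

Lemma cmod_square (c z : C) r : cmod (z - c) < r -> square c r z.
Proof.
by move=> h; split; apply: le_lt_trans h; rewrite -?cReB -?cImB ?cmod_Re ?cmod_Im.
Qed.

(** With the value [f' a] at [a] the quotient becomes continuous there, which is all that is asked
    at the exceptional point. *)
Lemma difference_quotient_primitive (f f' : C -> C) (c a : C) (d : R) : 0 < d ->
  (forall z, cmod (z - c) < d -> cder f z (f' z)) -> cmod (a - c) < d ->
  exists G, forall z, cmod (z - c) < d / 3 -> z <> a ->
    cder G z ((f z - f a) / (z - a)).
Proof.
move=> d0 hf ac.
pose g z := if z == a then f' a else (f z - f a) / (z - a).
have gd z : cmod (z - c) < d -> z <> a -> exists v, cder g z v.
  move=> zd /eqP za.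
  have za0 : 0 < cmod (z - a) by rewrite cmod_gt0 subr_eq0.
  have h1 := derB (hf _ zd) (der_cst id (f a) z).
  have h2 : cder (fun z => (z - a)^-1) z (- ((z - a)^-1 * (z - a)^-1) * (1 - 0)).
    apply: (@der_comp _ _ id (fun z => z - a) (fun w => w^-1)).
      exact: (derB (der_id id z) (der_cst id a z)).
    by apply: cder_inv; rewrite subr_eq0.
  eexists; apply: (der_eps za0 _ (derM h1 h2)) => w wz.
  rewrite /g; have [wa|//] := eqVneq w a.
  by move: wz; rewrite wa cmod_distC ltxx.
have [|z zd|G hG] := @local_primitive _ g c a d d0.
- move=> z zd; have [->|/eqP za] := eqVneq z a; last first.
    by have [v gv] := gd _ zd za; exact: cder_ccont gv.
  move=> e e0; have [d1 d10 h1] := hf _ ac _ e0.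
  exists d1 => // w wd; rewrite /g eqxx; have [_|wa] := eqVneq w a.
    by rewrite subrr cmod0 ltW.
  have wa0 : 0 < cmod (w - a) by rewrite cmod_gt0 subr_eq0.
  rewrite -(ler_pM2r wa0) -cmodM mulrBl divfK ?subr_eq0 //.
  exact: h1.
- exact: gd.
exists G => z /cmod_square/hG; rewrite /g; case: eqP => //.
Qed.

(* With [G] a primitive of the difference quotient of [f] at [c], the real part of
   [G] along a circle centred at [c] has derivative [Im (f c) - Im (f z)]; being
   monotone and periodic, it is constant. *)
Lemma maximum_principle (f f' : C -> C) (c : C) (d : R) : 0 < d ->
  (forall z, cmod (z - c) < d -> cder f z (f' z)) ->
  (forall z, cmod (z - c) < d -> Im (f z) <= Im (f c)) ->
  forall z, cmod (z - c) < d / 3 -> Im (f z) = Im (f c).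
Proof.
move=> d0 hf fle z zd.
have [|G hG] := @difference_quotient_primitive f f' c c d d0 hf.
  by rewrite subrr cmod0.
have [->//|zc] := eqVneq z c.
pose p t := circle c (z - c) t; pose phi t := Re (G (p t)).
have pc t : cmod (p t - c) = cmod (z - c) by exact: cmod_circle.
have pd t : cmod (p t - c) < d / 3 by rewrite pc.
have d3 : d / 3 < d by lra.
have pnc t : p t - c != 0 by rewrite -cmod_gt0 pc cmod_gt0 subr_eq0.
have dphi (t : R) : is_derive t 1 phi (Im (f c) - Im (f (p t))).
  have pt_nc : p t <> c by move/eqP; rewrite -subr_eq0 (negbTE (pnc t)).
  have /rder_Re := der_comp (rder_circle c (z - c) t) (hG _ (pd t) pt_nc).
  rewrite -/(p t) mulrCA mulrC divfK // mulrC.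
  by rewrite cReM /= mul0r mul1r sub0r cImB opprB.
have mono (a b : R) : a <= b -> phi a <= phi b.
  move=> ab; have [s _ E] := MVT_is_derive ab (fun t _ => dphi t).
  rewrite -subr_ge0 E mulr_ge0 ?subr_ge0 // fle //.
  exact: lt_trans (pd s) d3.
have p2 : phi (pi *+ 2) = phi 0 by rewrite /phi /p circle_2pi.
have pN2 : phi (- (pi *+ 2)) = phi 0 by rewrite /phi /p circleN2pi.
have pp : 0 < pi *+ 2 :> R by rewrite mulrn_wgt0 // pi_gt0.
have cst (t : R) : `|t| < pi *+ 2 -> phi t = phi 0.
  rewrite ltr_norml => /andP[t1 t2]; apply/eqP; rewrite eq_le.
  by rewrite -{1}p2 -{1}pN2 !mono // ltW.
have E : p 0 = z by rewrite /p circle0 addrC subrK.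
suff : Im (f c) - Im (f (p 0)) = 0.
  by rewrite E => /eqP; rewrite subr_eq0 => /eqP.
apply/eqP; rewrite -normr_eq0 eq_le normr_ge0 andbT.
apply/ler_addgt0Pr => e e0; rewrite add0r.
have [d1 d10 h1] := proj1 (is_derive_eps _ _ _) (dphi 0) e e0.
pose s := Num.min (d1 / 2) pi.
have s0 : 0 < s by rewrite lt_min divr_gt0 // pi_gt0.
have sd : s < d1 by rewrite gt_min; apply/orP; left; lra.
have sp : s < pi *+ 2.
  by rewrite gt_min; apply/orP; right; rewrite mulr2n ltrDl pi_gt0.
have := h1 s; rewrite subr0 gtr0_norm // => /(_ sd).
have -> : phi s = phi 0 by apply: cst; rewrite gtr0_norm.
by rewrite subrr sub0r normrN normrM (gtr0_norm s0) ler_pM2r.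
Qed.

(* The integral over [0, 2 pi], meaningful when [g] has an antiderivative. *)
Definition cint (g : R -> C) : C :=
  let U := xget (fun=> 0) [set U : R -> C | forall t, -1 < t -> rder U t (g t)] in
  U (pi *+ 2) - U 0.

Lemma pi2_ge0 : 0 <= pi *+ 2 :> R.
Proof. by rewrite mulrn_wge0 // ltW // pi_gt0. Qed.

(** Two antiderivatives differ by a function of zero derivative on [0, 2 pi]. Starting at -1 makes
    the derivative two-sided at 0. *)
Lemma cintE (U g : R -> C) : (forall t, -1 < t -> rder U t (g t)) ->
  cint g = U (pi *+ 2) - U 0.
Proof.
move=> hU; rewrite /cint; case: xgetP => [V _ hV|/(_ U)//].
apply/eqP; rewrite -subr_eq0.
have -> : V (pi *+ 2) - V 0 - (U (pi *+ 2) - U 0) =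
   (V (pi *+ 2) - U (pi *+ 2)) - (V 0 - U 0) by ring.
rewrite -cmod_eq0 eq_le cmod_ge0 andbT.
have := @rder_le _ (fun t => V t - U t) (fun t => g t - g t) _ _ 0 pi2_ge0.
rewrite mul0r; apply => t /andP[t0 _].
  by apply: derB; [apply: hV|apply: hU]; rewrite (lt_le_trans _ t0) ?ltrN10.
by rewrite subrr cmod0.
Qed.

Definition rdiff (g : R -> C) := forall t, exists v, rder g t v.

Lemma rdiff_rcont g t : rdiff g -> rcont g t.
Proof.
move=> /(_ t)[v gv] e e0; have [d d0 h] := der_cont gv e0.
by exists d => // s sd; rewrite ltW // h // -rcB cmod_rc.
Qed.

Lemma cint_prim g : rdiff g ->
  exists2 U, forall t, -1 < t -> rder U t (g t) & cint g = U (pi *+ 2) - U 0.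
Proof.
move=> dg; have [U hU] := rcont_antiderivative (-1) (fun t => rdiff_rcont t dg).
by exists U => //; exact: cintE.
Qed.

Lemma cintD f g : rdiff f -> rdiff g ->
  cint (fun t => f t + g t) = cint f + cint g.
Proof.
move=> /cint_prim[U hU ->] /cint_prim[V hV ->].
rewrite (@cintE (fun t => U t + V t)); first by ring.
by move=> t t1; apply: derD; [exact: hU|exact: hV].
Qed.

Lemma cintZ c g : rdiff g -> cint (fun t => c * g t) = c * cint g.
Proof.
move=> /cint_prim[U hU ->]; rewrite (@cintE (fun t => c * U t)); first by ring.
by move=> t t1; apply: derZ; exact: hU.
Qed.

Lemma cint_le g M : rdiff g -> (forall t, cmod (g t) <= M) ->
  cmod (cint g) <= M * (pi *+ 2).
Proof.
move=> /cint_prim[U hU ->] gM; rewrite -[X in M * X]subr0.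
apply: (rder_le pi2_ge0) => [t /andP[t0 _]|//].
by apply: hU; rewrite (lt_le_trans _ t0) ?ltrN10.
Qed.

Lemma rdiffD f g : rdiff f -> rdiff g -> rdiff (fun t => f t + g t).
Proof.
by move=> df dg t; have [u fu] := df t; have [v gv] := dg t; eexists; exact: derD fu gv.
Qed.

Lemma rdiffM f g : rdiff f -> rdiff g -> rdiff (fun t => f t * g t).
Proof.
by move=> df dg t; have [u fu] := df t; have [v gv] := dg t; eexists; exact: derM fu gv.
Qed.

Lemma rdiff_cst c : rdiff (fun=> c).
Proof. by move=> t; eexists; exact: der_cst. Qed.

Lemma rdiffV g : rdiff g -> (forall t, g t != 0) -> rdiff (fun t => (g t)^-1).
Proof.
move=> dg g0 t; have [v gv] := dg t; eexists.
exact: (der_comp gv (cder_inv (g0 t))).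
Qed.

(** Differentiation under the integral sign: a quadratic remainder uniform in [t] remains quadratic
    after integration. *)
Lemma cder_cint (K : C -> R -> C) (K' : R -> C) (a : C) (B r : R) : 0 < r ->
  (forall w, cmod (w - a) < r -> rdiff (K w)) -> rdiff K' ->
  (forall w, cmod (w - a) < r -> forall t,
    cmod (K w t - K a t - (w - a) * K' t) <= B * cmod (w - a) ^+ 2) ->
  cder (fun w => cint (K w)) a (cint K').
Proof.
move=> r0 dK dK' hB e e0.
pose M := `|B| * (pi *+ 2) + 1.
have M0 : 0 < M by rewrite ltr_wpDl // mulr_ge0 // pi2_ge0.
exists (Num.min r (e / M)) => [|w]; first by rewrite lt_min r0 divr_gt0.
rewrite lt_min => /andP[wr we].
have dKa : rdiff (K a) by apply: dK; rewrite subrr cmod0.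
have dN (g : R -> C) : rdiff g -> rdiff (fun t => -1 * g t).
  by move=> dg; apply: rdiffM => //; exact: rdiff_cst.
have -> : cint (K w) - cint (K a) - cint K' * (w - a) =
    cint (fun t => K w t + (-1 * K a t + - (w - a) * K' t)).
  rewrite cintD ?cintD ?cintZ //; first by ring.
  - exact: dN.
  - by apply: rdiffM => //; exact: rdiff_cst.
  - exact: dK.
  - apply: rdiffD; first exact: dN.
    by apply: rdiffM => //; exact: rdiff_cst.
have le t : cmod (K w t + (-1 * K a t + - (w - a) * K' t)) <= `|B| * cmod (w - a) ^+ 2.
  rewrite (_ : _ + _ = K w t - K a t - (w - a) * K' t); last by ring.
  by rewrite (le_trans (hB _ wr t)) // ler_wpM2r ?exprn_ge0 ?cmod_ge0 ?ler_norm.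
rewrite (le_trans (cint_le _ le)) //.
  apply: rdiffD; first exact: dK.
  by apply: rdiffD; [exact: dN|apply: rdiffM => //; exact: rdiff_cst].
rewrite expr2 mulrA mulrAC ler_wpM2r ?cmod_ge0 //.
rewrite ltr_pdivlMr // in we; apply: le_trans (ltW we).
rewrite -mulrA mulrCA ler_wpM2l ?cmod_ge0 // /M.
by rewrite lerDl.
Qed.

Lemma cmod_nat n : cmod (n%:R : C) = n%:R.
Proof. by apply: complexI; rewrite -normCE normr_nat rmorph_nat. Qed.

Lemma cmodX (z : C) n : cmod (z ^+ n) = cmod z ^+ n.
Proof. by apply: complexI; rewrite rmorphXn /= -!normCE normrX. Qed.

(** For A = g t - a and h = w - a, these are the first-order Taylor remainders of 1 / (A - h) and 1
    / (A - h)^2, namely h^2 / (A^2 (A - h)) and h^2 (3 A - 2 h) / (A^3 (A - h)^2). The constants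
    come from |A| >= rho and |A - h| >= rho / 2. *)
Lemma cauchy_kernel_bound (A h psi : C) (rho r M : R) : 0 < rho ->
  rho <= cmod A -> cmod A <= r -> cmod h < rho / 2 -> cmod psi <= M ->
  cmod (psi / (A - h) - psi / A - h * (psi / (A * A)))
    <= M * (2 / rho ^+ 3) * cmod h ^+ 2 /\
  cmod (psi / ((A - h) * (A - h)) - psi / (A * A) - h * (2 * psi / (A * A * A)))
    <= M * (4 * (3 * r + rho) / rho ^+ 5) * cmod h ^+ 2.
Proof.
move=> rho0 A1 A2 h1 psiM.
have M0 : 0 <= M by rewrite (le_trans (cmod_ge0 psi)).
have r0 : 0 <= r by rewrite (le_trans (cmod_ge0 A)).
have Ah : rho / 2 <= cmod (A - h).
  have := cmodD (A - h) h; rewrite subrK.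
  by move: h1 A1; move: (cmod _) (cmod _) (cmod _) => x y z; lra.
have A0 : A != 0 by rewrite -cmod_gt0 (lt_le_trans rho0).
have Ah0 : A - h != 0 by rewrite -cmod_gt0 (lt_le_trans _ Ah) // divr_gt0.
have inv1 : (cmod A)^-1 <= rho^-1 by rewrite lef_pV2 // posrE cmod_gt0.
have inv2 : (cmod (A - h))^-1 <= 2 / rho.
  by rewrite -[2 / rho]invrK invf_div lef_pV2 // posrE ?cmod_gt0 // divr_gt0.
have ge (x : C) : 0 <= (cmod x)^-1 by rewrite invr_ge0 cmod_ge0.
split.
  have -> : psi / (A - h) - psi / A - h * (psi / (A * A)) =
    psi * (A^-1 * A^-1 * (A - h)^-1) * h ^+ 2 by field; rewrite ?A0 ?Ah0.
  rewrite cmodM cmodX ler_wpM2r ?exprn_ge0 ?cmod_ge0 // cmodM.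
  rewrite ler_pM ?cmod_ge0 // !cmodM !cmodV.
  rewrite (_ : 2 / rho ^+ 3 = rho^-1 * rho^-1 * (2 / rho)); last by field; rewrite gt_eqF.
  by rewrite ler_pM ?mulr_ge0 // ler_pM.
have -> : psi / ((A - h) * (A - h)) - psi / (A * A) - h * (2 * psi / (A * A * A)) =
  psi * ((3 * A - 2 * h) * (A^-1 * A^-1 * A^-1 * ((A - h)^-1 * (A - h)^-1))) * h ^+ 2.
  by field; rewrite ?A0 ?Ah0.
rewrite cmodM cmodX ler_wpM2r ?exprn_ge0 ?cmod_ge0 // cmodM.
rewrite ler_pM ?cmod_ge0 // cmodM.
rewrite (_ : 4 * (3 * r + rho) / rho ^+ 5 =
  (3 * r + rho) * (rho^-1 * rho^-1 * rho^-1 * ((2 / rho) * (2 / rho)))); last first.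
  by field; rewrite gt_eqF.
rewrite ler_pM ?cmod_ge0 //.
  rewrite (le_trans (cmodB _ _)) // !cmodM.
  rewrite !cmod_nat.
  by move: h1 A2; move: (cmod _) (cmod _) => x y; lra.
rewrite !cmodM !cmodV ler_pM ?mulr_ge0 //.
  by rewrite ler_pM ?mulr_ge0 // ler_pM.
by rewrite ler_pM.
Qed.

Lemma cder0_cst (f : C -> C) (c : C) (d : R) :
  (forall z, cmod (z - c) < d -> cder f z 0) ->
  forall z, cmod (z - c) < d -> f z = f c.
Proof.
move=> hf z zd.
pose p t := c + rc t * (z - c).
have dp t : rder p t (z - c).
  have := derD (der_cst (@rc R) c t) (derZ (z - c) (der_id (@rc R) t)).
  by rewrite add0r mulr1; apply: der_ext => s; rewrite [_ * rc s]mulrC.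
have := @rder_le _ (f \o p) (fun=> 0) 0 1 0 ler01.
have p0 : p 0 = c by rewrite /p /rc rmorph0 mul0r addr0.
have p1 : p 1 = z by rewrite /p /rc rmorph1 mul1r addrC subrK.
rewrite mul0r /= p0 p1 => h.
apply/eqP; rewrite -subr_eq0 -cmod_eq0 eq_le cmod_ge0 andbT; apply: h => t t01.
  rewrite -(mul0r (z - c)); apply: der_comp (dp t) _; apply: hf.
  rewrite /p addrC addKr cmodM cmod_rc (le_lt_trans _ zd) //.
  by rewrite ler_piMl ?cmod_ge0 // ger0_norm; case/andP: t01.
by rewrite cmod0.
Qed.

(* Cauchy's formula is differentiated twice under the integral sign. The integral
   of dz / (z - a) over the circle does not depend on [a], since its derivative
   in [a] is the integral of the exact form dz / (z - a)^2. *)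
Lemma holomorphic_derivative (f f' : C -> C) (c : C) (d : R) : 0 < d ->
  (forall z, cmod (z - c) < d -> cder f z (f' z)) -> exists v, cder f' c v.
Proof.
move=> d0 hf.
have [d1 d10 hd1] := cder_ccont (hf c ltac:(by rewrite subrr cmod0)) ltr01.
(* The circle has to lie within d / 3 of [c], where difference quotients have a primitive, and
   within [d1], where |f| <= |f c| + 1. *)
pose r := Num.min d d1 / 6.
have r0 : 0 < r by rewrite divr_gt0 // lt_min d0.
have m1 : Num.min d d1 <= d by rewrite ge_min lexx.
have m2 : Num.min d d1 <= d1 by rewrite ge_min lexx orbT.
have rd : r < d / 3 by rewrite /r; move: m1 d0; move: (Num.min _ _) => x; lra.
have rd1 : r < d1 by rewrite /r; move: m2 d10; move: (Num.min _ _) => x; lra.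
pose g t := circle c (rc r) t.
have gr t : cmod (g t - c) = r by rewrite cmod_circle cmod_rc gtr0_norm.
have dg t : rder g t (ii * (g t - c)) by exact: rder_circle.
have gdiff : rdiff g by move=> t; eexists; exact: dg.
have gcd : rdiff (fun t => ii * (g t - c)).
  apply: rdiffM; first exact: rdiff_cst.
  by apply: rdiffD => //; exact: rdiff_cst.
have ga a t : cmod (a - c) < r -> r - cmod (a - c) <= cmod (g t - a).
  move=> _; have := cmod_dist_trans a (g t) c; rewrite gr.
  by move: (cmod _) (cmod _) => x y; lra.
have ga0 a t : cmod (a - c) < r -> g t - a != 0.
  by move=> ar; rewrite -cmod_gt0 (lt_le_trans _ (ga _ t ar)) // subr_gt0.
have gadiff a : rdiff (fun t => g t - a).
  by apply: rdiffD => //; exact: rdiff_cst.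
pose psi0 t := ii * (g t - c); pose psi t := f (g t) * psi0 t.
have fgdiff : rdiff (fun t => f (g t)).
  move=> t; eexists; apply: (der_comp (dg t) (hf _ _)).
  by rewrite gr (lt_trans rd) // ltr_pdivrMr // ltr_pMr // ltr1n.
have psidiff : rdiff psi by exact: rdiffM.
have k1diff (p : R -> C) a : rdiff p -> cmod (a - c) < r ->
    rdiff (fun t => p t / (g t - a)).
  by move=> dp ar; apply: rdiffM => //; apply: rdiffV => // t; exact: ga0.
have k2diff (p : R -> C) a : rdiff p -> cmod (a - c) < r ->
    rdiff (fun t => p t / ((g t - a) * (g t - a))).
  move=> dp ar; apply: rdiffM => //; apply: rdiffV => [|t]; first exact: rdiffM.
  by rewrite mulf_neq0 // ga0.
have k3diff (p : R -> C) a : rdiff p -> cmod (a - c) < r ->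
    rdiff (fun t => 2 * p t / ((g t - a) * (g t - a) * (g t - a))).
  move=> dp ar; apply: rdiffM => //.
    by apply: rdiffM => //; exact: rdiff_cst.
  apply: rdiffV => [|t]; first by do 2?apply: rdiffM.
  by rewrite !mulf_neq0 // ga0.
have psi0b t : cmod (psi0 t) = r by rewrite cmodM cmod_ii mul1r gr.
pose M := (cmod (f c) + 1) * r.
have psib t : cmod (psi t) <= M.
  rewrite cmodM psi0b ler_wpM2r ?(ltW r0) //.
  have := cmodD (f (g t) - f c) (f c); have := hd1 (g t); rewrite gr subrK.
  by move=> /(_ rd1); move: (cmod _) (cmod _) (cmod _) => x y u; lra.
have kernel (p : R -> C) (N : R) a : rdiff p -> (forall t, cmod (p t) <= N) ->
    cmod (a - c) < r ->
    cder (fun w => cint (fun t => p t / (g t - w))) a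
      (cint (fun t => p t / ((g t - a) * (g t - a)))) /\
    cder (fun w => cint (fun t => p t / ((g t - w) * (g t - w)))) a
      (cint (fun t => 2 * p t / ((g t - a) * (g t - a) * (g t - a)))).
  move=> dp pN ar; set rho := r - cmod (a - c).
  have rho0 : 0 < rho by rewrite subr_gt0.
  have rho2 : 0 < rho / 2 by rewrite divr_gt0.
  have wr w : cmod (w - a) < rho / 2 -> cmod (w - c) < r.
    move=> wa; rewrite (le_lt_trans (cmod_dist_trans a _ _)) //.
    by move: wa rho0; rewrite /rho; move: (cmod _) (cmod _) => x y; lra.
  have g2 t : cmod (g t - a) <= 2 * r.
    rewrite (le_trans (cmod_dist_trans c _ _)) // gr [cmod (c - a)]cmod_distC.
    by move: ar; move: (cmod _) => x; lra.
  have bd w t (wa : cmod (w - a) < rho / 2) :=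
    @cauchy_kernel_bound (g t - a) (w - a) (p t) rho (2 * r) N rho0 (ga _ t ar) (g2 t) wa (pN t).
  have E w t : g t - a - (w - a) = g t - w by ring.
  split.
    apply: (cder_cint rho2).
    - by move=> w /wr wr'; exact: k1diff.
    - exact: k2diff.
    - by move=> w wa t; have := (bd w t wa).1; rewrite E; exact.
  apply: (cder_cint rho2).
  - by move=> w /wr wr'; exact: k2diff.
  - exact: k3diff.
  - by move=> w wa t; have := (bd w t wa).2; rewrite E; exact.
have psi0N t : cmod (psi0 t) <= r by rewrite psi0b.
have cc : cmod (c - c) < r by rewrite subrr cmod0.
have N0 a : cmod (a - c) < r -> cint (fun t => psi0 t / (g t - a)) = ii * rc (pi *+ 2).
  move=> ar.
  rewrite (cder0_cst (f := fun w => cint (fun t => psi0 t / (g t - w))) _ ar) => [|w wr].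
    rewrite (@cintE (fun t => ii * rc t)) ?mulr0 ?subr0 // => t _.
    by rewrite /psi0 mulfK ?ga0 // -[ii in X in rder _ _ X]mulr1; exact/derZ/der_id.
  have [+ _] := kernel psi0 r w gcd psi0N wr.
  rewrite (@cintE (fun t => - (g t - w)^-1)).
    by rewrite /g circle_2pi subrr.
  move=> t _; apply: (der_ext (f := fun t => -1 * (g t - w)^-1)).
    by move=> s; rewrite mulN1r.
  have := derZ (-1) (der_comp (derB (dg t) (der_cst (@rc R) w t)) (cder_inv (ga0 _ t wr))).
  rewrite subr0 mulN1r mulNr opprK mulrC invfM; exact.
(* Write f (g t) as (f (g t) - f a) + f a. The first part has the primitive of the difference
   quotient and integrates to 0 over the closed circle; the second is f a times the integral in
   [N0]. *)
have cauchy a : cmod (a - c) < r ->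
    cint (fun t => psi t / (g t - a)) = ii * rc (pi *+ 2) * f a.
  move=> ar; have [|G hG] := @difference_quotient_primitive f f' c a d d0 hf.
    by rewrite (lt_trans ar) // (lt_trans rd) // ltr_pdivrMr // ltr_pMr // ltr1n.
  rewrite -(N0 _ ar) mulrC -cintZ; last exact: k1diff.
  have E t : psi t / (g t - a) =
      (f (g t) - f a) / (g t - a) * psi0 t + f a * (psi0 t / (g t - a)).
    by rewrite /psi; field; rewrite ga0.
  have qdiff : rdiff (fun t => (f (g t) - f a) / (g t - a) * psi0 t).
    apply: rdiffM => //; apply: k1diff => //; apply: rdiffD => //; exact: rdiff_cst.
  rewrite (funext E).
  rewrite cintD //; last by apply: rdiffM; [exact: rdiff_cst|exact: k1diff].
  rewrite (@cintE (G \o g) (fun t => (f (g t) - f a) / (g t - a) * psi0 t)).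
    by rewrite /= /g circle_2pi subrr add0r.
  move=> t _; apply: der_comp (dg t) _; apply: hG; first by rewrite gr.
  by move/eqP; rewrite -subr_eq0 (negbTE (ga0 _ t ar)).
have k0 : ii * rc (pi *+ 2) != 0 :> C.
  rewrite -cmod_gt0 cmodM cmod_ii mul1r cmod_rc normr_gt0 gt_eqF //.
  by rewrite mulrn_wgt0 // pi_gt0.
pose Phi a := cint (fun t => psi t / ((g t - a) * (g t - a))).
have f'E a : cmod (a - c) < r -> f' a = (ii * rc (pi *+ 2))^-1 * Phi a.
  move=> ar; have ad : cmod (a - c) < d.
    by rewrite (lt_trans ar) // (lt_trans rd) // ltr_pdivrMr // ltr_pMr // ltr1n.
  apply: cder_uniq (hf a ad) _.
  have [/(derZ (ii * rc (pi *+ 2))^-1) h _] := kernel psi M a psidiff psib ar.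
  have d' : 0 < r - cmod (a - c) by rewrite subr_gt0.
  apply: der_eps d' _ h => w wa; rewrite cauchy ?mulKf //.
  by rewrite (le_lt_trans (cmod_dist_trans a _ _)) // -ltrBrDr.
have [_ h] := kernel psi M c psidiff psib cc.
eexists; apply: (der_eps r0 _ (derZ (ii * rc (pi *+ 2))^-1 h)) => w /f'E ->.
by [].
Qed.

End Circle.

(** * Gluing of local primitives *)

Section Gluing.
Variables (R : realType) (V : normedModType R).
Notation C := (Cplx R).

(** The indicator of [u s = u 0] has derivative zero, so the mean value inequality takes the place
    of a connectedness argument. *)
Lemma locally_constant_segment (T : Type) (u : R -> T) :
  (forall t : R, 0 <= t <= 1 -> \forall s \near t, u s = u t) -> u 1 = u 0.
Proof.
move=> hu; pose chi s : C := if pselect (u s = u 0) then 1 else 0.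
have := @rder_le _ chi (fun=> 0) 0 1 0 ler01; rewrite mul0r.
have c0 : chi 0 = 1 by rewrite /chi; case: pselect.
rewrite c0 => h; suff : cmod (chi 1 - 1) <= 0.
  rewrite /chi; case: pselect => // ?; rewrite sub0r cmodN cmod1.
  by rewrite leNgt ltr01.
apply: h => t; last by rewrite cmod0.
move=> /hu /nbhs_ballP[d /= d0 hd] e e0; exists d => // s.
rewrite -rcB cmod_rc => st; have E : u s = u t by apply: hd; rewrite /ball /= distrC.
rewrite /chi E mul0r subrr subr0 cmod0.
by rewrite mulr_ge0 ?cmod_ge0 ?(ltW e0).
Qed.

(** At each point of the segment both [a] and [b] have the germ prescribed by [g], up to constants;
    so [a - b] is locally constant along it. *)
Lemma germs_segment (g : V -> V -> C) (a b : V -> C) (p q : V) :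
  (forall t : R, 0 <= t <= 1 -> let z := p + t *: (q - p) in
     (\forall z' \near z, a z' - a z = g z z' - g z z) /\
     (\forall z' \near z, b z' - b z = g z z' - g z z)) ->
  a q - a p = b q - b p.
Proof.
move=> h; pose u t := a (p + t *: (q - p)) - b (p + t *: (q - p)).
have : u 1 = u 0.
  apply: locally_constant_segment => t /h /= [ha hb].
  have ct : {for t, continuous (fun t : R => p + t *: (q - p))}.
    by apply: cvgD; [exact: cvg_cst|exact: (cvgZr_tmp cvg_id)].
  near=> s.
  have Ea : a (p + s *: (q - p)) - a (p + t *: (q - p)) = g (p + t *: (q - p)) (p + s *: (q - p)) -
      g (p + t *: (q - p)) (p + t *: (q - p)).
    by near: s; exact: ct ha.
  have Eb : b (p + s *: (q - p)) - b (p + t *: (q - p)) = g (p + t *: (q - p)) (p + s *: (q - p)) -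
      g (p + t *: (q - p)) (p + t *: (q - p)).
    by near: s; exact: ct hb.
  apply/eqP; rewrite -subr_eq0 /u.
  rewrite (_ : _ - _ - _ = (a (p + s *: (q - p)) - a (p + t *: (q - p))) -
    (b (p + s *: (q - p)) - b (p + t *: (q - p)))); last by ring.
  by rewrite Ea Eb subrr.
rewrite /u scale1r scale0r addr0 [p + _]addrC subrK => E.
have e : a q - a p - (b q - b p) = (a q - b q) - (a p - b p) by ring.
by apply/eqP; rewrite -subr_eq0 e E subrr.
Unshelve. all: by end_near. Qed.

(* [F x] is the sum of the increments of local solutions along a subdivision of
   the segment from 0 to [x], with a mesh below a Lebesgue number of [K]. When
   [x] moves, the contributions of neighbouring steps telescope. *)
Lemma gluing (K : set V) (g : V -> V -> C) (M : R) :
  compact K -> (forall x, K x -> `|x| <= M) ->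
  (forall x (t : R), K x -> 0 <= t <= 1 -> K (t *: x)) ->
  (forall y, K y -> \forall z \near y, \forall z' \near z,
     g y z' - g y z = g z z' - g z z) ->
  exists F : V -> C, forall z, K^° z -> \forall z' \near z,
    F z' - F z = g z z' - g z z.
Proof.
move=> cK KM starK hg.
(* The local solution attached to [y] is still a solution at [z]. *)
pose P y z := \forall z' \near z, g y z' - g y z = g z z' - g z z.
have [e e0 he] : exists2 e : R, 0 < e & forall x, K x -> exists y, forall z, `|x - z| < e -> P y z.
  have : \forall e \near (0 : R)^'+, K `<=` (fun x => exists y, forall z, `|x - z| < e -> P y z).
    move/compact_near_coveringP : cK; apply => x Kx.
    have /nbhs_ballP[d /= d0 hd] := hg x Kx.
    exists (ball x (d / 2), [set e | e < d / 2]) => /=.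
      split; first by apply: nbhsx_ballx; rewrite divr_gt0.
      by apply: nbhs_right_lt; rewrite divr_gt0.
    move=> [x' e] /= [xx' ed]; exists x => z x'z; apply: hd.
    rewrite -ball_normE /ball_/= in xx' *.
    rewrite (le_lt_trans (ler_distD x' _ _)) // [d]splitr ltrD //.
    exact: lt_trans ed.
  move=> h; have [e [e0 he]] := filter_ex (filterI (nbhs_right_gt (0 : R)) h).
  by exists e.
have [Y hY] : {Y : V -> V & forall x, K x -> forall z, `|x - z| < e -> P (Y x) z}.
  apply: (@choice _ _ (fun x y => K x -> forall z, `|x - z| < e -> P y z)) => x.
  have [/he[y hy]|nK] := pselect (K x); first by exists y.
  by exists 0.
pose N := (Num.bound (`|M| / (e / 2))).+1.
have e20 : 0 < e / 2 by rewrite divr_gt0.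
have N0 : 0 < N%:R :> R by rewrite ltr0n.
have MN : `|M| / N%:R < e / 2.
  rewrite ltr_pdivrMr // mulrC -ltr_pdivrMr //.
  apply: lt_le_trans (archi_boundP _) _; first by rewrite divr_ge0 // ltW.
  by rewrite ler_nat.
pose pt_ (x : V) (k : nat) : V := (k%:R / N%:R) *: x.
pose S x n := \sum_(0 <= k < n) (g (Y (pt_ x k)) (pt_ x k.+1) - g (Y (pt_ x k)) (pt_ x k)).
have kN k : (k <= N)%N -> 0 <= (k%:R / N%:R : R) <= 1.
  by move=> kN; rewrite divr_ge0 //= ler_pdivrMr // mul1r ler_nat.
have ptK x k : K x -> (k <= N)%N -> K (pt_ x k).
  by move=> Kx /kN; exact: starK.
have pt_dist x x' k : (k <= N)%N -> `|pt_ x k - pt_ x' k| <= `|x - x'|.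
  move=> /kN/andP[k0 k1]; rewrite -scalerBr normrZ ger0_norm //.
  by rewrite ler_piMl.
have pt_step x k : K x -> `|pt_ x k - pt_ x k.+1| < e / 2.
  move=> /KM xM; rewrite -scalerBl -mulrBl -[k.+1]addn1 natrD opprD addrA subrr sub0r.
  rewrite mulNr scaleNr normrN normrZ mul1r gtr0_norm ?invr_gt0 // mulrC.
  apply: le_lt_trans MN; rewrite ler_wpM2r ?invr_ge0 ?(ltW N0) //.
  exact: le_trans xM (ler_norm _).
have segd (a p q : V) (t : R) : 0 <= t <= 1 ->
    `|a - (p + t *: (q - p))| <= `|a - p| + `|p - q|.
  move=> /andP[t0 t1]; rewrite opprD addrA (le_trans (ler_normB _ _)) // lerD2l.
  by rewrite normrZ ger0_norm // distrC ler_piMl.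
exists (S ^~ N) => x Kx0; have Kx : K x by exact: interior_subset Kx0.
have main x' : K x' -> `|x - x'| < e / 2 -> forall k, (k <= N)%N ->
    S x' k - S x k = g (Y (pt_ x k)) (pt_ x' k) - g (Y (pt_ x k)) (pt_ x k).
  move=> Kx' xx'; elim=> [_|k IH kN1].
    rewrite /S !big_geq // subrr (_ : pt_ x' 0 = pt_ x 0) ?subrr //.
    by rewrite /pt_ !mul0r !scale0r.
  have kN0 := ltnW kN1.
  have dk : `|pt_ x k - pt_ x' k| < e / 2 by exact: le_lt_trans (pt_dist _ _ _ kN0) xx'.
  have dk1 : `|pt_ x k.+1 - pt_ x' k.+1| < e / 2.
    exact: le_lt_trans (pt_dist _ _ _ kN1) xx'.
  have s1 := pt_step x k Kx; have s2 := pt_step x' k Kx'.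
  (* [E1] replaces the solution chosen at the k-th point of x' by the one chosen at that of x, along
     a step of x'. [E2] passes to the solution chosen at the next point of x, across the gap between
     x and x'. *)
  have E1 : g (Y (pt_ x' k)) (pt_ x' k.+1) - g (Y (pt_ x' k)) (pt_ x' k) =
      g (Y (pt_ x k)) (pt_ x' k.+1) - g (Y (pt_ x k)) (pt_ x' k).
    apply: (@germs_segment g) => t t01 /=; split.
      apply: (hY _ (ptK _ _ Kx' kN0)); rewrite (le_lt_trans (segd _ _ _ _ t01)) //.
      by rewrite subrr normr0 add0r (lt_trans s2) // [ltRHS]splitr ltrDl.
    apply: (hY _ (ptK _ _ Kx kN0)); rewrite (le_lt_trans (segd _ _ _ _ t01)) //.
    by rewrite [e]splitr ltrD.
  have E2 : g (Y (pt_ x k)) (pt_ x' k.+1) - g (Y (pt_ x k)) (pt_ x k.+1) =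
      g (Y (pt_ x k.+1)) (pt_ x' k.+1) - g (Y (pt_ x k.+1)) (pt_ x k.+1).
    apply: (@germs_segment g) => t t01 /=; split.
      apply: (hY _ (ptK _ _ Kx kN0)); rewrite (le_lt_trans (segd _ _ _ _ t01)) //.
      by rewrite [e]splitr ltrD.
    apply: (hY _ (ptK _ _ Kx kN1)); rewrite (le_lt_trans (segd _ _ _ _ t01)) //.
    by rewrite subrr normr0 add0r (lt_trans dk1) // [ltRHS]splitr ltrDl.
  rewrite -E2 /S !big_nat_recr //= -/(S x k) -/(S x' k) E1.
  move: (IH kN0) => /eqP; rewrite subr_eq => /eqP ->; ring.
have ptN y : pt_ y N = y by rewrite /pt_ divff ?scale1r ?gt_eqF.
have Pxx : P (Y x) x by apply: (hY x Kx); rewrite subrr normr0.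
near=> x'.
have Kx' : K x' by near: x'; exact: Kx0.
have xx' : `|x - x'| < e / 2.
  near: x'; apply/nbhs_ballP; exists (e / 2) => //= z.
  by rewrite -ball_normE.
by rewrite main // !ptN; near: x'.
Unshelve. all: by end_near. Qed.

End Gluing.

(** * Primitives of holomorphic forms *)

Section LocalPrimitives.
Variables (R : realType) (X : topologicalType) (A : complex_atlas R X).
Notation C := (Cplx R).
Implicit Types (w : oneform A) (G : X -> C) (x y : X) (i j : chart_index A).

(* The differential of [G] at [x] is [w]. *)
Definition hasd w G x := forall i, cdom (A i) x ->
  cder (G \o icoord (A i)) (A i x) (w i x).

Lemma chart_icoord i x : cdom (A i) x -> icoord (A i) (A i x) = x.
Proof. by move=> ix; apply: (@chartK _ _ (A i)); rewrite inE. Qed.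

Lemma chart_near i x (d : R) : cdom (A i) x -> 0 < d ->
  \forall y \near x, cdom (A i) y /\ cmod (A i y - A i x) < d.
Proof.
move=> ix d0; apply: filterI; first by apply: open_nbhs_nbhs; split=> //; exact: chart_dom_open.
have : {for x, continuous (A i)} by apply: (@chart_continuous _ _ (A i)); rewrite inE.
move=> c; apply: (c [set z | cmod (z - A i x) < d]).
by apply/nbhs_cplx; exists d.
Qed.

Lemma chart_ball i x (P : set X) : cdom (A i) x -> nbhs x P ->
  exists2 d : R, 0 < d & forall z, cmod (z - A i x) < d ->
    [/\ cdom (A i) (icoord (A i) z), A i (icoord (A i) z) = z & P (icoord (A i) z)].
Proof.
move=> ix xP.
have img : (A i @` cdom (A i)) (A i x) by exists x.
have ci : {for A i x, continuous (icoord (A i))}.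
  by apply: (@ichart_continuous _ _ (A i)); rewrite inE.
have : nbhs (A i x) ((A i @` cdom (A i)) `&` (icoord (A i) @^-1` P)).
  apply: filterI.
    by apply: open_nbhs_nbhs; split => //; exact: chart_img_open.
  by apply: ci; rewrite /= chart_icoord.
move=> /nbhs_cplx[d d0 hd]; exists d => // z /hd[[y iy <-] Py].
by move: Py; rewrite /= !chart_icoord.
Qed.

Lemma chart_change i j x : cdom (A i) x -> cdom (A j) x ->
  cder (A j \o icoord (A i)) (A i x) (derive1 (A j \o icoord (A i)) (A i x)).
Proof. by move=> ix jx; apply/derivable_cder/atlas_compat; exists x. Qed.

Lemma near_join_nbhs (T : topologicalType) (x : T) (P : set T) :
  (\forall y \near x, P y) -> \forall y \near x, \forall z \near y, P z.
Proof. exact: near_join. Qed.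

Lemma local_primitive_form w x : holomorphic_oneform w ->
  exists G, \forall y \near x, hasd w G y.
Proof.
move=> [hw1 hw2]; have [i ix] := atlas_cover A x.
have [d d0 hd] := chart_ball ix (filterT : nbhs x setT).
have hf z : cmod (z - A i x) < d -> exists v, cder (w i \o icoord (A i)) z v.
  move=> /hd[iz zE _]; eexists; apply/derivable_cder/hw1.
  by exists (icoord (A i) z).
have [|z /hf + _|F hF] := @local_primitive _ (w i \o icoord (A i)) (A i x) 0 d d0.
- by move=> z /hf[v]; exact: cder_ccont.
- by [].
exists (F \o A i).
have d3 : 0 < d / 3 by rewrite divr_gt0.
apply: filterS (chart_near ix d3) => y [iy yd] j jy.
rewrite (hw2 j i y jy iy).
apply: (der_comp (i := id) (chart_change jy iy)).
rewrite /= chart_icoord //.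
have := hF (A i y) (cmod_square yd); by rewrite /= chart_icoord.
Qed.

Lemma hasd_continuous w G x : hasd w G x -> {for x, continuous G}.
Proof.
have [i ix] := atlas_cover A x => hG U /nbhs_cplx[e e0 he].
have [d d0 h] := der_cont (hG i ix) e0.
apply: filterS (chart_near ix d0) => y [iy yd]; apply: he.
by have := h _ yd; rewrite /= !chart_icoord.
Qed.

Lemma hasd0_cst w G x : (forall i y, cdom (A i) y -> w i y = 0) ->
  (\forall y \near x, hasd w G y) -> \forall y \near x, G y = G x.
Proof.
move=> w0; have [i ix] := atlas_cover A x => /(chart_ball ix)[d d0 hd].
apply: filterS (chart_near ix d0) => y [iy yd].
have := @cder0_cst _ (G \o icoord (A i)) (A i x) d _ _ yd.
rewrite /= !chart_icoord //; apply => z /hd[iz zE hz].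
by have := hz i iz; rewrite zE w0.
Qed.

Lemma hasdB w w' G G' x : hasd w G x -> hasd w' G' x ->
  hasd (fun i y => w i y - w' i y) (fun y => G y - G' y) x.
Proof. by move=> h h' i ix; apply: derB; [exact: h|exact: h']. Qed.

Lemma hasdZ w G x (c : C) : hasd w G x ->
  hasd (fun i y => c * w i y) (fun y => c * G y) x.
Proof. by move=> h i ix; apply: derZ; exact: h. Qed.

Lemma hasd_sum n (w : 'I_n -> oneform A) (G : 'I_n -> X -> C) x :
  (forall k, hasd (w k) (G k) x) ->
  hasd (fun i y => \sum_k w k i y) (fun y => \sum_k G k y) x.
Proof.
elim: n w G => [|n IH] w G h i ix.
  rewrite big_ord0; apply: (der_ext (f := fun=> 0)); last exact: der_cst.
  by move=> z; rewrite /= big_ord0.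
rewrite big_ord_recl; apply: (der_ext (f := fun z =>
  G ord0 (icoord (A i) z) + \sum_(k < n) G (fintype.lift ord0 k) (icoord (A i) z))).
  by move=> z; rewrite /= big_ord_recl.
apply: derD; first exact: h.
by apply: (IH (fun k => w (fintype.lift ord0 k)) (fun k => G (fintype.lift ord0 k))).
Qed.

Lemma hasd_ext w w' G x : (forall i, cdom (A i) x -> w i x = w' i x) ->
  hasd w G x -> hasd w' G x.
Proof. by move=> ww h i ix; rewrite -ww //; exact: h. Qed.

Lemma hasd_unique w G G' x :
  (\forall y \near x, hasd w G y) -> (\forall y \near x, hasd w G' y) ->
  \forall y \near x, G y - G x = G' y - G' x.
Proof.
move=> hG hG'; have : \forall y \near x, hasd (fun i y => w i y - w i y) (fun y => G y - G' y) y.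
  by near=> y; apply: hasdB; near: y.
move=> /hasd0_cst h; have {}h := h (fun i y _ => subrr _).
apply: filterS h => y h; have e : G y - G x - (G' y - G' x) = (G y - G' y) - (G x - G' x) by ring.
by apply/eqP; rewrite -subr_eq0 e h subrr.
Unshelve. all: by end_near. Qed.

Section Along.
Variables (V : topologicalType) (s : V -> X).

(* [F] is a primitive of the pull-back of [w] by [s], near [z]. *)
Definition prim_along w (F : V -> C) (z : V) := exists G : X -> C,
  (\forall y \near s z, hasd w G y) /\
  \forall z' \near z, F z' - F z = G (s z') - G (s z).

(** The local primitive hidden in [prim_along] may be exchanged for any other, the two differing by
    a constant near [s z]. *)
Lemma prim_along_any w F z G : {for z, continuous s} -> prim_along w F z ->
  (\forall y \near s z, hasd w G y) ->
  \forall z' \near z, F z' - F z = G (s z') - G (s z).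
Proof.
move=> cs [G' [hG' FG']] hG; have := cs _ (hasd_unique hG' hG).
by apply: filterS2 FG' => z' /= -> ->.
Qed.

Lemma prim_along_continuous w F z : {for z, continuous s} -> prim_along w F z ->
  {for z, continuous F}.
Proof.
move=> cs [G [hG FG]] U /nbhs_cplx[e e0 he].
have cG : {for s z, continuous G} by exact: hasd_continuous (nbhs_singleton hG).
have : nbhs (G (s z)) [set c | cmod (c - G (s z)) < e] by apply/nbhs_cplx; exists e.
move=> /cG /cs; apply: filterS2 FG => z' E /= h.
by apply: he; rewrite E.
Qed.

End Along.

Lemma prim_along_comp (U V : topologicalType) (s : V -> X) (c : U -> V) w F u :
  {for u, continuous c} -> prim_along s w F (c u) ->
  prim_along (s \o c) w (F \o c) u.
Proof.
by move=> cc [G [hG FG]]; exists G; split => //; exact: cc FG.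
Qed.

(** [gluing] applied to the local primitives chosen at the points [s z]; their compatibility is
    [hasd_unique]. *)
Lemma prim_along_exists (V : normedModType R) (s : V -> X) w (K : set V) (M : R) :
  holomorphic_oneform w -> continuous s ->
  compact K -> (forall z, K z -> `|z| <= M) ->
  (forall z (t : R), K z -> 0 <= t <= 1 -> K (t *: z)) ->
  exists F : V -> C, forall z, K^° z -> prim_along s w F z.
Proof.
move=> hw cs cK KM starK.
have [G hG] : {G : X -> X -> C & forall x, \forall y \near x, hasd w (G x) y}.
  exact: (choice (fun x => local_primitive_form x hw)).
have [|F hF] := @gluing R V K (fun z z' : V => G (s z) (s z')) M cK KM starK.
  move=> y _.
  have h1 : \forall z \near y, \forall x \near s z, hasd w (G (s y)) x.
    exact: cs _ _ (near_join (hG (s y))).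
  apply: filterS h1 => z h.
  have h2 : \forall z' \near z, G (s y) (s z') - G (s y) (s z) = G (s z) (s z') - G (s z) (s z).
    exact: cs _ _ (hasd_unique h (hG (s z))).
  exact: h2.
exists F => z Kz; exists (G (s z)); split; first exact: hG.
exact: hF.
Qed.

(** The integral of [w] along a path that need only be continuous. *)
Definition pathint w (p : R -> X) (c : C) := exists F : R -> C,
  (forall t : R, 0 <= t <= 1 -> prim_along p w F t) /\ c = F 1 - F 0.

Lemma pathint_unique w p c c' : continuous p ->
  pathint w p c -> pathint w p c' -> c = c'.
Proof.
move=> cp [F [hF ->]] [F' [hF' ->]].
have := @locally_constant_segment R C (fun t => F t - F' t).
move=> h; have {}h : F 1 - F' 1 = F 0 - F' 0.
  apply: h => t t01; have [G [hG FG]] := hF t t01.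
  have := prim_along_any (cp t) (hF' t t01) hG.
  apply: filterS2 FG => s E E'; apply/eqP; rewrite -subr_eq0.
  have -> : F s - F' s - (F t - F' t) = (F s - F t) - (F' s - F' t) by ring.
  by rewrite E E' subrr.
have e : F 1 - F 0 - (F' 1 - F' 0) = (F 1 - F' 1) - (F 0 - F' 0) by ring.
by apply/eqP; rewrite -subr_eq0 e h subrr.
Qed.

Lemma itv_star (a b t u : R) : a <= 0 -> 0 <= b -> a <= u <= b -> 0 <= t <= 1 ->
  a <= t * u <= b.
Proof. by move=> *; apply/andP; split; nra. Qed.

Lemma pathint_exists w p : holomorphic_oneform w -> continuous p ->
  exists c, pathint w p c.
Proof.
move=> hw cp.
(* [gluing] speaks only of interior points of a set star-shaped about 0, hence an interval larger
   than [0, 1]. *)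
have [||F hF] := @prim_along_exists R^o p w `[-1, 2]%classic 2 hw cp (@segment_compact _ _ _).
- by move=> x; rewrite /= in_itv /= ler_norml => /andP[h1 h2]; rewrite h2 andbT; lra.
- by move=> x t; rewrite /= !in_itv /=; apply: itv_star.
exists (F 1 - F 0); exists F; split => // t /andP[t0 t1]; apply: hF.
have : nbhs (t : R) `](-1), 2[%classic.
  by apply: near_in_itvoo; rewrite in_itv /=; apply/andP; lra.
apply: filterS => s; rewrite /= !in_itv /= => /andP[/ltW -> /ltW ->] //.
Qed.

End LocalPrimitives.

(** * Integration on singular chains *)

Section Simplices.
Variable R : realType.
Notation C := (Cplx R).

Lemma continuous_rV (U : topologicalType) n (f : U -> 'rV[R]_n) :
  (forall j, continuous (fun u => f u ord0 j)) -> continuous f.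
Proof.
move=> cf u V /nbhs_ballP[e /= e0 he].
have h (j : 'I_n) : \forall v \near u, ball (f u ord0 j) e (f v ord0 j).
  by apply: (cf j u); exact: nbhsx_ballx.
apply: filterS (filter_forall _ h) => v hv; apply: he; split=> // i j.
by rewrite (ord1 i).
Qed.

Definition cl (t : R) : R := clampR 0 1 t.

Lemma cl_id t : 0 <= t <= 1 -> cl t = t. Proof. exact: clampR_id. Qed.

Lemma cl_in t : 0 <= cl t <= 1. Proof. exact: clampR_in. Qed.

Lemma cl_clamped t : cl (cl t) = cl t. Proof. by rewrite cl_id // cl_in. Qed.

Lemma cl_continuous : continuous cl.
Proof.
move=> t; apply/continuous_at_eps => e e0; exists e => // s st.
by rewrite (le_trans (clampR_lip _ _ ler01)) // ltW.
Qed.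

(** Clamping the parameter gives a continuous map on all of [R], so that primitives can be sought on
    a neighbourhood of [0, 1]. *)
Definition edge_fun (t : R) : 'rV[R]_2 :=
  \row_j (if val j is 0%N then 1 - cl t else cl t).

Lemma edge_funP t : edge_fun t \in simplex R 1.
Proof.
apply/mem_set; have /andP[t0 t1] := cl_in t; split => [j|].
  by rewrite mxE; case: (val j) => [|_]; rewrite ?subr_ge0.
by rewrite !big_ord_recl big_ord0 !mxE /= addr0 subrK.
Qed.

Definition edge (t : R) : simplex R 1 := SigSub (edge_funP t).

(** The unit square mapped onto the triangle with its side p.1 = 0 collapsed to vertex 0; the other
    three sides parametrize the three faces. *)
Definition triangle_fun (p : R * R) : 'rV[R]_3 :=
  \row_j (match val j with 0%N => 1 - cl p.1 | 1%N => cl p.1 * (1 - cl p.2)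
          | _ => cl p.1 * cl p.2 end).

Lemma triangle_funP p : triangle_fun p \in simplex R 2.
Proof.
apply/mem_set; have /andP[t0 t1] := cl_in p.1; have /andP[u0 u1] := cl_in p.2.
split => [j|].
  by rewrite mxE; case: (val j) => [|[|_]]; rewrite ?mulr_ge0 ?subr_ge0.
by rewrite !big_ord_recl big_ord0 !mxE /= addr0; ring.
Qed.

Definition triangle (p : R * R) : simplex R 2 := SigSub (triangle_funP p).

Lemma edge_continuous : continuous edge.
Proof.
apply/continuous_comp_initial.
have -> : set_val \o edge = edge_fun by [].
apply: continuous_rV => j t.
rewrite (_ : (fun u => _) = if val j is 0%N then fun u => 1 - cl u else cl).
  case: (val j) => [|_]; last exact: cl_continuous.
  by apply: cvgB; [exact: cvg_cst|exact: cl_continuous].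
by apply/funext => u; rewrite mxE; case: (val j).
Qed.

Lemma triangle_continuous : continuous triangle.
Proof.
apply/continuous_comp_initial.
have -> : set_val \o triangle = triangle_fun by [].
have c1 : continuous (fun p : R * R => cl p.1).
  by move=> p; apply: (@continuous_comp _ _ _ fst cl); [exact: cvg_fst|exact: cl_continuous].
have c2 : continuous (fun p : R * R => cl p.2).
  by move=> p; apply: (@continuous_comp _ _ _ snd cl); [exact: cvg_snd|exact: cl_continuous].
apply: continuous_rV => j p.
rewrite (_ : (fun u => _) = match val j with 0%N => fun u => 1 - cl u.1
  | 1%N => fun u => cl u.1 * (1 - cl u.2) | _ => fun u => cl u.1 * cl u.2 end).
  case: (val j) => [|[|_]].
  - by apply: cvgB; [exact: cvg_cst|exact: c1].
  - by apply: cvgM; [exact: c1|apply: cvgB; [exact: cvg_cst|exact: c2]].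
  - by apply: cvgM; [exact: c1|exact: c2].
by apply/funext => u; rewrite mxE; case: (val j) => [|[|]].
Qed.

Lemma cl0 : cl 0 = 0. Proof. by rewrite cl_id // lexx ler01. Qed.
Lemma cl1 : cl 1 = 1. Proof. by rewrite cl_id // lexx ler01. Qed.

Lemma face_edge (i : 'I_3) t : face i (edge t) =
  triangle (match val i with 0%N => (1, t) | 1%N => (t, 1) | _ => (t, 0) end).
Proof.
apply: val_inj; apply/rowP => j; rewrite !mxE; case: unliftP => [k|] -> /=.
  rewrite mxE; case: i => -[|[|[|//]]] ? /=; case: k => -[|[|//]] ? /=;
  by rewrite ?cl0 ?cl1; ring.
by case: i => -[|[|[|//]]] ? /=; rewrite ?cl0 ?cl1; ring.
Qed.

Lemma face_vertex (i : 'I_2) (v : simplex R 0) :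
  face i v = edge (if val i is 0%N then 1 else 0).
Proof.
have v0 (k : 'I_1) : val v ord0 k = 1.
  by have [_] := set_mem (valP v); rewrite big_ord1 [k]ord1.
apply: val_inj; apply/rowP => j; rewrite !mxE; case: unliftP => [k|] -> /=.
  rewrite v0; case: i => -[|[|//]] ? /=; case: k => -[|//] ? /=; by rewrite ?cl0 ?cl1 //; ring.
by case: i => -[|[|//]] ? /=; rewrite ?cl0 ?cl1; ring.
Qed.

End Simplices.

Section Integration.
Variables (R : realType) (X : topologicalType) (A : complex_atlas R X).
Notation C := (Cplx R).
Implicit Types (w : oneform A).

Lemma simplex_edge_continuous (s : singular_simplex R X 1) : continuous (s \o @edge R).
Proof.
by move=> t; apply: continuous_comp; [exact: edge_continuous|exact: cts_fun].
Qed.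

Definition intS w (s : singular_simplex R X 1) : C :=
  xget 0 [set c | pathint w (s \o @edge R) c].

Lemma intSE w (s : singular_simplex R X 1) c : pathint w (s \o @edge R) c -> intS w s = c.
Proof.
move=> h; rewrite /intS; case: xgetP => [c' _ h'|/(_ c)//].
exact: pathint_unique (@simplex_edge_continuous s) h' h.
Qed.

Lemma intSP w (s : singular_simplex R X 1) : holomorphic_oneform w -> pathint w (s \o @edge R) (intS w s).
Proof.
move=> hw; have [c hc] := pathint_exists hw (@simplex_edge_continuous s).
by rewrite (intSE hc).
Qed.

Definition intC w (c : chain R X 1) : C :=
  @fglift int (zmodule C) _ (intS w) c.

Lemma intC_is_additive w : additive (intC w).
Proof. exact: (@lift_is_additive int _ (zmodule C) (intS w)). Qed.

HB.instance Definition _ w :=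
  GRing.isAdditive.Build (chain R X 1) C (intC w) (intC_is_additive w).

Lemma boundary_is_additive n : additive (@boundary_map R X n).
Proof. exact: lift_is_additive. Qed.

HB.instance Definition _ n :=
  GRing.isAdditive.Build (chain R X n.+1) (chain R X n) (@boundary_map R X n)
    (@boundary_is_additive n).

Lemma intCU w s k : intC w << k *g s >> = intS w s *~ k.
Proof. by rewrite /intC liftU. Qed.

Lemma boundaryU n (s : singular_simplex R X n.+1) :
  boundary_map << s >> =
  \sum_(i < n.+2) << (-1) ^+ i *g (s \o face i : singular_simplex R X n) >>.
Proof. by rewrite /boundary_map liftU scale1r. Qed.

(** With a primitive [F] on the square, each face contributes the increment of [F] along a side. The
    alternating sum reduces to the increment along the collapsed side, where the map to the surface
    is constant. *)
Lemma intS_boundary w (s : singular_simplex R X 2) : holomorphic_oneform w ->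
  intC w (boundary_map << s >>) = 0.
Proof.
move=> hw; rewrite boundaryU !big_ord_recl big_ord0 addr0 !raddfD /= !intCU.
have cs : continuous (s \o @triangle R).
  by move=> t; apply: continuous_comp; [exact: triangle_continuous|exact: cts_fun].
pose K := `[-1, 2]%classic `*` `[-1, 2]%classic : set (R^o * R^o)%type.
have [|||F hF] := @prim_along_exists R X A (R^o * R^o)%type (s \o @triangle R) w K 2 hw cs.
- by apply: compact_setX; exact: segment_compact.
- move=> [x y] /= []; rewrite /= !in_itv /= => /andP[h1 h2] /andP[h3 h4].
  by rewrite prod_normE /= ge_max !ler_norml h2 h4 !andbT; apply/andP; lra.
- move=> [x y] t /= []; rewrite /= !in_itv /= => h1 h2 t01.
  by split; rewrite /= in_itv /=; apply: itv_star.
have {}hF (u v : R) : 0 <= u <= 1 -> 0 <= v <= 1 -> prim_along (s \o @triangle R) w F (u, v).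
  move=> u01 v01; apply: hF.
  have nb (x : R) : 0 <= x <= 1 -> nbhs (x : R) (`[-1, 2]%classic : set R).
    move=> /andP[x0 x1]; have : nbhs (x : R) `](-1), 2[%classic.
      by apply: near_in_itvoo; rewrite in_itv /=; apply/andP; lra.
    by apply: filterS => y; rewrite /= !in_itv /= => /andP[/ltW -> /ltW ->].
  by exists (`[-1, 2]%classic, `[-1, 2]%classic) => //; split; exact: nb.
have key (i : 'I_3) (c : R -> R^o * R^o) : continuous c ->
    (forall t, face i (edge t) = triangle (c t)) ->
    (forall t, 0 <= t <= 1 -> 0 <= (c t).1 <= 1 /\ 0 <= (c t).2 <= 1) ->
    intS w (s \o face i) = F (c 1) - F (c 0).
  move=> cc fc c01; apply: intSE; exists (F \o c); split => // t t01.
  have -> : (s \o face i) \o @edge R = (s \o @triangle R) \o c.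
    by apply/funext => u; rewrite /= fc.
  apply: prim_along_comp; first exact: cc.
  by have [h1 h2] := c01 _ t01; move: (c t) h1 h2 => [u v]; exact: hF.
have le01 : 0 <= (1 : R) <= 1 by rewrite ler01 lexx.
have le00 : 0 <= (0 : R) <= 1 by rewrite ler01 lexx.
have c1 (a : R) : continuous (fun t : R => (a, t) : R^o * R^o).
  move=> t U [[P Q] /= [hP hQ] PQ]; apply: filterS hQ => y Qy; apply: (PQ (a, y)).
  by split => //=; exact: nbhs_singleton hP.
have c2 (a : R) : continuous (fun t : R => (t, a) : R^o * R^o).
  move=> t U [[P Q] /= [hP hQ] PQ]; apply: filterS hP => y Py; apply: (PQ (y, a)).
  by split => //=; exact: nbhs_singleton hQ.
rewrite (@key _ (fun t => (1, t))) //; last by move=> t; exact: face_edge.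
rewrite (@key _ (fun t => (t, 1))) //; last by move=> t; exact: face_edge.
rewrite (@key _ (fun t => (t, 0))) //; last by move=> t; exact: face_edge.
(* Along the collapsed side the image does not move, so [F] is locally constant there. *)
have E : F (0, 1) = F (0, 0).
  apply: (@locally_constant_segment R C (fun t => F (0, t))) => t t01.
  have [G [_ hG]] := prim_along_comp (@c1 0 t) (hF 0 t le00 t01).
  apply: (filterS _ hG) => u /= h.
  apply/eqP; rewrite -subr_eq0 h subr_eq0; apply/eqP; congr (G (s _)).
  by apply: val_inj; apply/rowP => j; rewrite !mxE /= cl0; case: (val j) => [|[|]] //; rewrite !mul0r.
rewrite /= expr0 expr1 sqrrN expr1n !mulr1z mulrN1z E. ring.
Qed.

Lemma intC_boundary w (e : chain R X 2) : holomorphic_oneform w ->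
  intC w (boundary_map e) = 0.
Proof.
move=> hw; rewrite -(freeg_sumE e) !raddf_sum /= big1 // => s _.
have -> : << coeff s e *g s >> = << s >> *~ coeff s e.
  by rewrite freegU_mulz intz.
by rewrite !raddfMz /= intS_boundary // mul0rz.
Qed.

End Integration.

(** * Global primitives modulo periods *)

Section Global.
Variables (R : realType) (X : topologicalType) (A : complex_atlas R X).
Notation C := (Cplx R).
Implicit Types (w : oneform A) (x y : X).

Definition point_fun x (_ : simplex R 0) : X := x.

Lemma point_continuous x : continuous (point_fun x).
Proof. exact: cst_continuous. Qed.

HB.instance Definition _ x :=
  @isContinuous.Build _ _ (point_fun x) (@point_continuous x).

Definition point x : chain R X 0 := << (point_fun x : singular_simplex R X 0) >>.

Lemma boundary_edge (s : singular_simplex R X 1) :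
  boundary_map << s >> = point (s (edge 1)) - point (s (edge 0)).
Proof.
rewrite boundaryU !big_ord_recl big_ord0 addr0 /point freegUN.
congr (<< _ *g _ >> + << _ *g _ >>); first last.
- by apply/continuousEP => v; rewrite /= /point_fun face_vertex.
- by apply/continuousEP => v; rewrite /= /point_fun face_vertex.
Qed.

Definition path_fun (p : R -> X) (v : simplex R 1) : X := p (val v ord0 ord_max).

Lemma path_fun_continuous p : continuous p -> continuous (path_fun p).
Proof.
move=> cp v; apply: (@continuous_comp _ _ _ (fun u : simplex R 1 => val u ord0 ord_max) p);
  last exact: cp.
apply: (@continuous_comp _ _ _ _ (fun y : 'rV[R]_2 => y ord0 ord_max)).
  exact: initial_continuous.
exact: coord_continuous.
Qed.

Lemma path_fun_edge p t : path_fun p (edge t) = p (cl t).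
Proof. by rewrite /path_fun /= mxE. Qed.

Lemma near_const_connected (T : Type) (u : X -> T) : connected [set: X] ->
  (forall x, \forall y \near x, u y = u x) -> forall x y, u x = u y.
Proof.
move=> cX hu x y; pose B := [set z | u x = u z].
have : B = setT.
  apply: cX; first by exists x.
    exists B; last by rewrite setTI.
    by rewrite openE => z uz; apply: filterS (hu z) => z' E; rewrite /B /= E.
  exists B; last by rewrite setTI.
  rewrite -[B]setCK; apply: open_closedC; rewrite openE => z uz.
  by apply: filterS (hu z) => z' E; rewrite /B /= E.
by move=> E; have : B y by rewrite E.
Qed.

(** The chain is one simplex, the straight segment from [x] to [y] read in a chart. It stays in a
    disc where [G] is a primitive, so [G] along it computes the integral. *)
Lemma segment_chain w x (G : X -> C) : (\forall y \near x, hasd w G y) ->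
  \forall y \near x, exists c : chain R X 1,
    boundary_map c = point y - point x /\ intC w c = G y - G x.
Proof.
move=> hG; have [i ix] := atlas_cover A x.
have [d d0 hd] := chart_ball ix (near_join hG).
apply: filterS (chart_near ix d0) => y [iy yd].
pose q t : C := A i x + rc (cl t) * (A i y - A i x).
have qd t : cmod (q t - A i x) < d.
  rewrite /q addrC addKr cmodM cmod_rc; have /andP[t0 t1] := cl_in t.
  by rewrite ger0_norm // (le_lt_trans _ yd) // ler_piMl // cmod_ge0.
have cq t : {for t, continuous q}.
  move=> U /nbhs_cplx[e e0 he].
  have k0 : 0 < cmod (A i y - A i x) + 1 by rewrite ltr_wpDl ?cmod_ge0.
  have : nbhs (t : R) (ball t (e / (cmod (A i y - A i x) + 1))).
    by apply: nbhsx_ballx; rewrite divr_gt0.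
  apply: filterS => s; rewrite /ball /= distrC => st; apply: he.
  rewrite /q opprD addrACA subrr add0r -mulrBl cmodM -rcB cmod_rc.
  rewrite (le_lt_trans (ler_wpM2r (cmod_ge0 _) (clampR_lip _ _ ler01))) //.
  rewrite ltr_pdivlMr // in st; apply: le_lt_trans st.
  by rewrite ler_wpM2l // lerDl.
pose p t := icoord (A i) (q t).
have cp : continuous p.
  move=> t; apply: (@continuous_comp _ _ _ q (icoord (A i))); first exact: cq.
  have [iq qE _] := hd _ (qd t); apply: (@ichart_continuous _ _ (A i)).
  by rewrite inE; exists (p t).
pose s : singular_simplex R X 1 := mkcts (path_fun_continuous cp).
have sE t : s (edge t) = p t.
  by rewrite -[LHS]/(path_fun p (edge t)) path_fun_edge /p /q cl_clamped.
have p0 : p 0 = x by rewrite /p /q cl0 /rc rmorph0 mul0r addr0 chart_icoord.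
have p1 : p 1 = y by rewrite /p /q cl1 /rc rmorph1 mul1r addrC subrK chart_icoord.
exists << s >>; split; first by rewrite boundary_edge !sE p0 p1.
rewrite intCU mulr1z; apply: intSE; exists (G \o p).
rewrite /= p0 p1; split => // t _; exists G.
rewrite /= sE; split; first by have [] := hd _ (qd t).
by near=> s'; rewrite /= !sE.
Unshelve. all: by end_near. Qed.

Lemma chain_between x y : connected [set: X] ->
  exists c : chain R X 1, boundary_map c = point y - point x.
Proof.
move=> cX; pose r z := exists c : chain R X 1, boundary_map c = point z - point x.
(* Only the boundary clause of [segment_chain] is wanted, so the zero form with the zero primitive
   serves. *)
pose w0 : oneform A := fun _ _ => 0.
suff E : r x = r y by rewrite -/(r y) -E; exists 0; rewrite raddf0 subrr.
apply: (near_const_connected cX) => {}y.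
have h0 : \forall z \near y, hasd w0 (fun=> 0) z.
  by near=> z => i iz; exact: der_cst.
apply: filterS (segment_chain h0) => z [c [bc _]].
apply/propext; split=> -[d bd].
  by exists (d - c); rewrite raddfB /= bd bc opprB addrC addrA subrK.
by exists (d + c); rewrite raddfD /= bd bc addrC addrA subrK.
Unshelve. all: by end_near. Qed.

Definition subgroup (Gam : set C) := Gam 0 /\ forall a b, Gam a -> Gam b -> Gam (a - b).

(** [J x] integrates [w] over a chosen chain from a base point to [x]. For [y] near [x], the chosen
    chains and the short segment combine into a cycle, whose integral lies in [Gam]. Later [Gam] is
    the lattice, or the set of real numbers. *)
Lemma primitive_mod w (Gam : set C) : connected [set: X] ->
  (forall c : chain R X 1, boundary_map c = 0 -> Gam (intC w c)) ->
  exists J : X -> C, forall x (G : X -> C), (\forall y \near x, hasd w G y) ->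
    \forall y \near x, Gam (J y - J x - (G y - G x)).
Proof.
move=> cX per; have [[x0]|nX] := pselect ([set: X] !=set0); last first.
  by exists (fun=> 0) => x; case: nX; exists x.
move=> _; have [c hc] := choice (fun x => chain_between x0 x cX).
exists (fun x => intC w (c x)) => x G hG.
apply: filterS (segment_chain hG) => y [d [bd <-]].
rewrite -!raddfB; apply: per; rewrite !raddfB /= !hc bd.
by rewrite [- (point x - _)]opprB addrA subrK subrr.
Qed.

Lemma cycle_intC w (I : finType) (z : I -> chain R X 1) (Gam : set C) :
  holomorphic_oneform w -> subgroup Gam -> homology_basis z ->
  (forall i, Gam (intC w (z i))) ->
  forall c : chain R X 1, boundary_map c = 0 -> Gam (intC w c).
Proof.
move=> hw [G0 GB] [_ hz] Gz c /hz[a [[e be] _]].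
have GN u : Gam u -> Gam (- u) by rewrite -sub0r; exact: GB.
have GD u v : Gam u -> Gam v -> Gam (u + v).
  by move=> hu hv; rewrite -[v]opprK; apply: GB => //; exact: GN.
have Gn u n : Gam u -> Gam (u *+ n).
  by move=> hu; elim: n => [|n IH]; rewrite ?mulr0n // mulrS; exact: GD.
have := intC_boundary e hw; rewrite be raddfB /= => /eqP; rewrite subr_eq0 => /eqP ->.
rewrite raddf_sum /=; apply: big_ind => // i _; rewrite raddfMz /=.
by case: (a i) => n; [exact: Gn|rewrite NegzE mulrNz; exact/GN/Gn].
Qed.

(** Increments in a direction [k] give Im (v k) = 0; the directions [ii] and 1 kill the real and the
    imaginary part of [v]. *)
Lemma Im_cst_cder0 (F : C -> C) (z v : C) (d : R) : 0 < d ->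
  (forall u, cmod (u - z) < d -> Im (F u) = Im (F z)) -> cder F z v -> v = 0.
Proof.
move=> d0 hF Fv.
have key (k : C) (e : R) : 0 < e -> cmod k = 1 -> `|Im (v * k)| <= e.
  move=> e0 k1; have [d1 d10 h] := Fv _ e0.
  pose s := Num.min (d / 2) (d1 / 2).
  have s0 : 0 < s by rewrite lt_min !divr_gt0.
  have sd : s < d by rewrite gt_min; apply/orP; left; lra.
  have sd1 : s < d1 by rewrite gt_min; apply/orP; right; lra.
  have E : z + k * rc s - z = k * rc s by rewrite addrC addKr.
  have n : cmod (k * rc s) = s by rewrite cmodM k1 mul1r cmod_rc gtr0_norm.
  have := h (z + k * rc s); rewrite E n => /(_ sd1) /(le_trans (cmod_Im _)).
  rewrite !cImB hF ?E ?n // subrr sub0r normrN mulrA cImM /= mulr0 add0r.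
  by rewrite normrM (gtr0_norm s0) ler_pM2r.
apply: complexP.
  apply/eqP; rewrite -normr_eq0 eq_le normr_ge0 andbT.
  apply/ler_addgt0Pr => e e0; rewrite add0r.
  by have := key ii e e0 (cmod_ii R); rewrite cImM /= mulr1 mulr0 addr0.
apply/eqP; rewrite -normr_eq0 eq_le normr_ge0 andbT.
apply/ler_addgt0Pr => e e0; rewrite add0r.
by have := key 1 e e0 (cmod1 R); rewrite mulr1.
Qed.

(** Modulo the reals the primitive [J] has a well-defined imaginary part [u], locally that of a
    holomorphic primitive up to a constant. By compactness [u] has a maximum; the set where it is
    attained is closed, and open by [maximum_principle]. *)
Lemma real_periods_eq0 w : [set: X] !=set0 -> compact [set: X] ->
  connected [set: X] -> holomorphic_oneform w ->
  (forall c : chain R X 1, boundary_map c = 0 -> Im (intC w c) = 0) ->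
  forall i x, cdom (A i) x -> w i x = 0.
Proof.
move=> X0 kX cX hw per.
have [J hJ] := @primitive_mod w [set c | Im c = 0] cX per.
pose u x := Im (J x).
have hu x (G : X -> C) : (\forall y \near x, hasd w G y) ->
    \forall y \near x, u y = u x + (Im (G y) - Im (G x)).
  move=> /hJ; apply: filterS => y; rewrite /= !cImB => /eqP.
  by rewrite subr_eq0 subr_eq addrC => /eqP.
have cu : continuous u.
  move=> x; have [G hG] := local_primitive_form x hw.
  have cG := hasd_continuous (nbhs_singleton hG).
  move=> U /nbhs_ballP[e /= e0 he].
  have : nbhs x [set y | cmod (G y - G x) < e].
    by apply: (cG [set z | cmod (z - G x) < e]); apply/nbhs_cplx; exists e.
  apply: filterS2 (hu x G hG) => y E /= yd; apply: he; rewrite /ball /= E.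
  by rewrite opprD addrA subrr sub0r normrN -cImB (le_lt_trans (cmod_Im _)).
have [c _ umax] := compact_EVT_max X0 kX (continuous_subspaceT cu).
have {}umax x : u x <= u c by apply: umax; rewrite inE.
have ucst x : u x = u c.
  suff : (u x = u c) = (u c = u c) by move=> ->.
  (* The locally constant function is the proposition [u x = u c] itself. *)
  apply: (@near_const_connected _ (fun x => u x = u c) cX) => {}x.
  have [E|nE] := pselect (u x = u c); last first.
    have : \forall y \near x, u y != u c.
      apply: (cu x [set r | r != u c]); apply/nbhs_ballP.
      exists `|u x - u c| => /=; first by rewrite normr_gt0 subr_eq0; exact/eqP.
      by move=> r; rewrite /ball /=; apply: contraTneq => ->; rewrite ltxx.
    apply: filterS => y /eqP ny; apply/propext; split => //.
  have [G hG] := local_primitive_form x hw.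
  have [i ix] := atlas_cover A x.
  have [d d0 hd] := chart_ball ix (filterI hG (hu x G hG)).
  have d3 : 0 < d / 3 by rewrite divr_gt0.
  apply: filterS (chart_near ix d3) => y [iy yd]; apply/propext; split => // _.
  have yd' : cmod (A i y - A i x) < d by rewrite (lt_le_trans yd) //; lra.
  have := @maximum_principle _ (G \o icoord (A i)) (w i \o icoord (A i)) (A i x) d d0 _ _ _ yd.
  rewrite /= !chart_icoord // => h.
  have [_ _ [_ E']] := hd _ yd'; rewrite chart_icoord // in E'.
  rewrite E' h ?subrr ?addr0 //.
    by move=> z /hd[iz zE [/(_ i iz) + _]]; rewrite zE.
  move=> z /hd[iz zE [_ uz]]; have := umax (icoord (A i) z).
  by rewrite uz E gerDl subr_le0.
move=> i x ix; have [G hG] := local_primitive_form x hw.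
have [d d0 hd] := chart_ball ix (hu x G hG).
apply: (Im_cst_cder0 d0 _ (nbhs_singleton hG i ix)) => z /hd[_ _].
rewrite !ucst => /eqP; rewrite -subr_eq0 opprD addrA subrr sub0r oppr_eq0 subr_eq0.
by move=> /eqP; rewrite /= chart_icoord.
Qed.

End Global.

(** * Periods along loops *)

Section Periods.
Variables (R : realType) (X : topologicalType) (A : complex_atlas R X).
Notation C := (Cplx R).
Implicit Types (w : oneform A) (g : loop A) (t : R).

Lemma rder_velocity (u : R -> C) t v : rder u t v -> velocity u t = v.
Proof.
move=> /rder_is_derive[[_ h1] [_ h2]].
by apply: complexP; rewrite /velocity /= derive1E.
Qed.

Lemma loop_rder g i t : cdom (A i) (g t) ->
  rder (A i \o g) t (velocity (A i \o g) t).
Proof.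
move=> /loop_C1[h1 h2 _]; apply/rder_is_derive.
by split; split; [exact: h1|rewrite -derive1E|exact: h2|rewrite -derive1E].
Qed.

Lemma loop_near g i t : cdom (A i) (g t) -> \forall s \near t, cdom (A i) (g s).
Proof.
move=> it; apply: (@loop_continuous _ _ _ g t (cdom (A i))); apply: open_nbhs_nbhs.
by split=> //; exact: chart_dom_open.
Qed.

Lemma near_real t (P : set R) : (\forall s \near t, P s) <->
  exists2 d : R, 0 < d & forall s, `|s - t| < d -> P s.
Proof.
split=> [/nbhs_ballP[d /= d0 hd]|[d d0 hd]].
  by exists d => // s sd; apply: hd; rewrite /ball /= distrC.
by apply/nbhs_ballP; exists d => // s; rewrite /ball /= distrC; exact: hd.
Qed.

Lemma rder_near (u v : R -> C) t l : (\forall s \near t, u s = v s) ->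
  rder u t l -> rder v t l.
Proof.
move=> /near_real[d d0 hd]; apply: der_eps d0 _ => s; rewrite -rcB cmod_rc.
exact: hd.
Qed.

(** [integrand] selects a chart at each [t] with no coherence between nearby times. The derivative
    of the change of charts cancels between form and velocity, so one fixed chart can be used near a
    given time. *)
Lemma integrand_chart w g i t : holomorphic_oneform w -> cdom (A i) (g t) ->
  integrand w g t = w i (g t) * velocity (A i \o g) t.
Proof.
move=> [_ hw] it; rewrite /integrand; set j := chart_at A (g t).
have jt : cdom (A j) (g t) by rewrite /j /chart_at; case: cid.
rewrite (hw j i _ jt it) -mulrA; congr (_ * _).
have := der_comp (loop_rder jt) (chart_change jt it).
have e : \forall s \near t, ((A i \o icoord (A j)) \o (A j \o g)) s = (A i \o g) s.
  by apply: filterS (loop_near jt) => s js; rewrite /= chart_icoord.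
by move=> /(rder_near e)/rder_velocity.
Qed.

Lemma rcont_of_continuous (u : R -> C) t : {for t, continuous u} -> rcont u t.
Proof.
move=> cu e e0; have : nbhs (t : R) [set s | cmod (u s - u t) < e].
  by apply: (cu [set z | cmod (z - u t) < e]); apply/nbhs_cplx; exists e.
by move=> /near_real[d d0 hd]; exists d => // s /hd /ltW.
Qed.

Lemma integrand_rcont w g t : holomorphic_oneform w -> rcont (integrand w g) t.
Proof.
move=> hw; have [i it] := atlas_cover A (g t).
have c1 : {for t, continuous (fun s => w i (g s))}.
  have h : {for g t, continuous (w i)}.
    have [v /cder_ccont hv] : exists v, cder (w i \o icoord (A i)) (A i (g t)) v.
      by eexists; apply/derivable_cder/hw.1; exists (g t).
    move=> U /nbhs_cplx[e e0 he]; have e20 : 0 < e / 2 by rewrite divr_gt0.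
    have [d d0 hd] := hv _ e20.
    apply: filterS (chart_near it d0) => y [iy yd]; apply: he.
    have := hd _ yd; rewrite /= !chart_icoord // => /le_lt_trans; apply; lra.
  by apply: (@continuous_comp _ _ _ g (w i)) => //; exact: loop_continuous.
have [_ _ c2] := loop_C1 it.
have c3 : {for t, continuous (fun s => w i (g s) * velocity (A i \o g) s)}.
  exact: cvgM c1 c2.
have /near_real[d d0 hd] : \forall s \near t,
    integrand w g s = w i (g s) * velocity (A i \o g) s.
  by apply: filterS (loop_near it) => s; exact: integrand_chart.
move=> e /(rcont_of_continuous c3)[d' d'0 hd'].
exists (Num.min d d') => [|s]; first by rewrite lt_min d0.
by rewrite lt_min => /andP[/hd -> /hd']; rewrite hd // subrr normr0.
Qed.

Lemma cl_near t : 0 < t < 1 -> \forall s \near t, cl s = s.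
Proof.
move=> t01; have : nbhs (t : R) `]0, 1[%classic.
  by apply: near_in_itvoo; rewrite in_itv.
by apply: filterS => s; rewrite /= in_itv /= => /andP[/ltW s0 /ltW s1]; rewrite cl_id ?s0.
Qed.

(** The clamped loop may fail to be differentiable at 0 and 1, hence the open interval;
    [integral_FTC] asks only for continuity at the ends. *)
Lemma prim_along_loop_rder w g F t : holomorphic_oneform w -> 0 < t < 1 ->
  prim_along (g \o @cl R) w F t -> rder F t (integrand w g t).
Proof.
move=> hw t01 [G []]; have ct : cl t = t.
  by case/andP: t01 => /ltW t0 /ltW t1; rewrite cl_id ?t0.
rewrite /= ct => hG FG; set i := chart_at A (g t).
have it : cdom (A i) (g t) by rewrite /i /chart_at; case: cid.
have h1 := der_comp (loop_rder it) (nbhs_singleton hG i it).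
have h2 := derD h1 (der_cst (@rc R) (F t - G (g t)) t).
rewrite addr0 in h2; apply: rder_near h2.
apply: filterS3 FG (loop_near it) (cl_near t01) => s E is_ cs.
rewrite /= chart_icoord // in E *; rewrite cs in E.
by rewrite addrCA -E addrC subrK.
Qed.

Lemma integral_FTC (f F : R -> R) : (forall t, {for t, continuous f}) ->
  (forall t, 0 < t < 1 -> is_derive t 1 F (f t)) ->
  {for (0 : R), continuous F} -> {for (1 : R), continuous F} ->
  \int[lebesgue_measure]_(t in `[0, 1]) f t = F 1 - F 0.
Proof.
move=> cf dF c0 c1.
rewrite /Rintegral (@continuous_FTC2 R f F 0 1 ltr01) //.
- exact: continuous_subspaceT.
- split; last exact: cvg_at_left_filter c1.
    by move=> t; rewrite in_itv /= => /dF; case.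
  exact: cvg_at_right_filter c0.
- by move=> t; rewrite in_itv /= => /dF[_ h]; rewrite derive1E.
Qed.

Lemma Re_continuous_at (F : R -> C) t : {for t, continuous F} ->
  {for t, continuous (Re \o F)} /\ {for t, continuous (Im \o F)}.
Proof. by move=> /rcont_of_continuous/rcontP. Qed.

(** The link between the integral defining periods and integration over singular chains: a primitive
    along the loop is an antiderivative of the integrand. *)
Lemma period_intS w g : holomorphic_oneform w ->
  period w g = intC w (loop_chain g).
Proof.
move=> hw; rewrite intCU mulr1z.
have pE : (loop_simplex_fun g) \o @edge R = g \o @cl R.
  by apply/funext => t; exact: path_fun_edge.
have [F [hF ->]] := intSP (loop_simplex_fun g : singular_simplex R X 1) hw.
rewrite pE in hF.
have cg t : {for t, continuous (g \o @cl R)}.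
  by apply: continuous_comp; [exact: cl_continuous|exact: loop_continuous].
have cF t : 0 <= t <= 1 -> {for t, continuous F}.
  by move=> /hF; apply: prim_along_continuous.
have le01 : 0 <= (1 : R) <= 1 by rewrite ler01 lexx.
have le00 : 0 <= (0 : R) <= 1 by rewrite ler01 lexx.
have [cR0 cI0] := Re_continuous_at (cF _ le00).
have [cR1 cI1] := Re_continuous_at (cF _ le01).
have dF t : 0 < t < 1 -> rder F t (integrand w g t).
  move=> t01; apply: prim_along_loop_rder => //; apply: hF.
  by case/andP: t01 => /ltW -> /ltW ->.
have ci t := proj1 (rcontP _ _) (integrand_rcont g t hw).
have -> : period w g = ((Re (F 1) - Re (F 0)) +i* (Im (F 1) - Im (F 0)))%C.
  congr Complex.
    apply: (@integral_FTC (fun t => Re (integrand w g t)) (Re \o F)) => // t.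
      exact: (ci t).1.
    by move=> /dF /rder_Re.
  apply: (@integral_FTC (fun t => Im (integrand w g t)) (Im \o F)) => // t.
    exact: (ci t).2.
  by move=> /dF /rder_Im.
by apply: complexP; rewrite /= ?cReB ?cImB.
Qed.

Lemma pathint_sum h (w : 'I_h -> oneform A) (e : oneform A) (v : 'I_h -> C) p
    (c : 'I_h -> C) : continuous p ->
  (forall i x, cdom (A i) x -> e i x = \sum_k v k * w k i x) ->
  (forall k, pathint (w k) p (c k)) -> pathint e p (\sum_k v k * c k).
Proof.
move=> cp ew hc; have [F hF] := choice hc.
exists (fun t => \sum_k v k * F k t); split; last first.
  rewrite -sumrB; apply: eq_bigr => k _; rewrite -mulrBr; congr (_ * _).
  exact: (hF k).2.
move=> t t01; have [G hG] := choice (fun k => (hF k).1 t t01).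
exists (fun x => \sum_k v k * G k x); split.
  have h1 : \forall x \near p t, forall k, hasd (w k) (G k) x.
    by apply: filter_forall => k; exact: (hG k).1.
  apply: filterS h1 => x hx.
  apply: (@hasd_ext _ _ _ (fun i y => \sum_k v k * w k i y)).
    by move=> i ix; rewrite -ew.
  by apply: hasd_sum => k; exact: hasdZ.
have h2 : \forall s \near t, forall k, F k s - F k t = G k (p s) - G k (p t).
  pose P (k : 'I_h) := [set s : R | F k s - F k t = G k (p s) - G k (p t)].
  have FF : Filter (nbhs (t : R)) by exact: nbhs_filter.
  exact: (@filter_forall R 'I_h P (nbhs (t : R)) FF (fun k => (hG k).2)).
apply: filterS h2 => s hs; rewrite -!sumrB; apply: eq_bigr => k _.
by rewrite -!mulrBr hs.
Qed.

Lemma period_sum h (w : 'I_h -> oneform A) (e : oneform A) (v : 'I_h -> C) g :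
  holomorphic_oneform e -> (forall k, holomorphic_oneform (w k)) ->
  (forall i x, cdom (A i) x -> e i x = \sum_k v k * w k i x) ->
  period e g = \sum_k v k * period (w k) g.
Proof.
move=> he hw ew; rewrite period_intS // intCU mulr1z.
apply: intSE; apply: pathint_sum ew _; first exact: simplex_edge_continuous.
by move=> k; rewrite period_intS // intCU mulr1z; exact: intSP.
Qed.

Lemma holomorphic_sum h (w : 'I_h -> oneform A) (v : 'I_h -> C) :
  (forall k, holomorphic_oneform (w k)) ->
  holomorphic_oneform (fun i x => \sum_k v k * w k i x).
Proof.
move=> hw; split.
  move=> i z iz.
  rewrite (_ : _ \o _ = \sum_k (v k \*: (w k i \o icoord (A i)))); last first.
    by apply/funext => u; rewrite fct_sumE.
  apply: derivable_sum => k; apply: derivableZ; exact: (hw k).1.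
move=> i j x ix jx; rewrite mulr_suml; apply: eq_bigr => k _.
by rewrite ((hw k).2 i j x ix jx) mulrA.
Qed.

Lemma symplectic_cycle_intC h (a b : 'I_h -> loop A) w (Gam : set C) :
  symplectic_basis a b -> holomorphic_oneform w -> subgroup Gam ->
  (forall j, Gam (period w (a j))) -> (forall j, Gam (period w (b j))) ->
  forall c : chain R X 1, boundary_map c = 0 -> Gam (intC w c).
Proof.
move=> [hz _] hw hGam ha hb; apply: cycle_intC hz _ => // -[j|j];
by rewrite -period_intS.
Qed.

End Periods.

(** * Maps to a torus *)

Section TorusMaps.
Variables (R : realType) (X : topologicalType) (A : complex_atlas R X).
Variables (tau : Cplx R) (tau_gt0 : 0 < Im tau).
Notation C := (Cplx R).
Notation B := (torus_atlas tau_gt0).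
Implicit Types (x y : X) (j : chart_index B).

Lemma lattice_discrete :
  exists2 r : R, 0 < r & forall z : C, lattice tau z -> cmod z < r -> z = 0.
Proof.
exists (Num.min 1 (Im tau)); first by rewrite lt_min ltr01.
move=> z lz zr; apply: (lattice_gap tau_gt0 lz).
by rewrite /torus_radius -rmorphD -splitr normCE ltcR.
Qed.

Lemma lattice_near_cst (g : X -> C) x : {for x, continuous g} ->
  (\forall y \near x, lattice tau (g y)) -> \forall y \near x, g y = g x.
Proof.
move=> cg lg; have [r r0 hr] := lattice_discrete.
have : nbhs x [set y | cmod (g y - g x) < r].
  by apply: (cg [set z | cmod (z - g x) < r]); apply/nbhs_cplx; exists r.
have lx := nbhs_singleton lg.
apply: filterS2 lg => y ly yr; apply/eqP; rewrite -subr_eq0; apply/eqP/hr => //.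
exact: latticeD ly (latticeN lx).
Qed.

Lemma torus_coord j (u : torus tau) : cdom (B j) u -> torus_pi tau (B j u) = u.
Proof. by case/torus_liftP. Qed.

Lemma torus_coord_sub j j' (u : torus tau) : cdom (B j) u -> cdom (B j') u ->
  lattice tau (B j u - B j' u).
Proof. by move=> ju j'u; apply/torus_piP; rewrite !torus_coord. Qed.

(** * The pull-back of dz by a holomorphic map to the torus *)

Section Pullback.
Variable (f : X -> torus tau).
Hypothesis hf : holomorphic_map A B f.

(** The coefficient of the pull-back of dz. Two charts of the torus differ locally by a lattice
    constant, so any chart at [f x] gives the same derivative. *)
Definition pullback : oneform A := fun i x =>
  derive1 (B (chart_at B (f x)) \o f \o icoord (A i)) (A i x).

Lemma preimage_chart_near j x : cdom (B j) (f x) -> \forall y \near x, cdom (B j) (f y).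
Proof.
move=> jx; apply: (hf.1 x (cdom (B j))); apply: open_nbhs_nbhs.
by split=> //; exact: chart_dom_open.
Qed.

Lemma coord_map_continuous j x : cdom (B j) (f x) -> {for x, continuous (B j \o f)}.
Proof.
move=> jx; apply: continuous_comp; first exact: hf.1.
by apply: (@chart_continuous _ _ (B j)); rewrite inE.
Qed.

Lemma pullback_hasd j x : cdom (B j) (f x) ->
  \forall y \near x, hasd pullback (B j \o f) y.
Proof.
move=> /preimage_chart_near/near_join_nbhs; apply: filterS => y jy i iy.
pose k := chart_at B (f y).
have ky : cdom (B k) (f y) by rewrite /k /chart_at; case: cid.
have jy0 := nbhs_singleton jy.
have h : cder (B k \o f \o icoord (A i)) (A i y) (pullback i y).
  by apply: derivable_cder; apply: hf.2; exists y.
have cg : {for y, continuous (fun z => B j (f z) - B k (f z))}.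
  by apply: cvgB; [exact: (coord_map_continuous jy0)|exact: (coord_map_continuous ky)].
have lg : \forall z \near y, lattice tau (B j (f z) - B k (f z)).
  by apply: filterS2 jy (preimage_chart_near ky) => z; exact: torus_coord_sub.
have [d d0 hd] := chart_ball iy (lattice_near_cst cg lg).
have := derD h (der_cst id (B j (f y) - B k (f y)) (A i y)); rewrite addr0.
apply: der_eps d0 _ => z /hd[_ _ E].
by rewrite /= -E addrC subrK.
Qed.

Lemma pullback_local x : exists j, cdom (B j) (f x) /\
  \forall y \near x, hasd pullback (B j \o f) y.
Proof. by have [j jx] := atlas_cover B (f x); exists j; split=> //; exact: pullback_hasd. Qed.

(** The coefficient is the derivative of a coordinate of [f], so its holomorphy is
    [holomorphic_derivative]; the transition rule is the chain rule with uniqueness of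
    derivatives. *)
Lemma pullback_holomorphic : holomorphic_oneform pullback.
Proof.
split=> [i _ [x ix <-]|i j x ix jx].
  have [k [kx hk]] := pullback_local x.
  have [d d0 hd] := chart_ball ix hk.
  have [z /hd[iz zE /(_ i iz)]|v hv] := @holomorphic_derivative _
    ((B k \o f) \o icoord (A i)) (pullback i \o icoord (A i)) (A i x) d d0.
    by rewrite zE.
  by have [] := proj1 (cder_derivable _ _ _) hv.
have [k [kx hk]] := pullback_local x.
have h := nbhs_singleton hk.
apply: cder_uniq (h i ix) _.
have hj : cder ((B k \o f) \o icoord (A j)) ((A j \o icoord (A i)) (A i x)) (pullback j x).
  by rewrite /= chart_icoord //; exact: h.
have [d d0 hd] := chart_ball ix (chart_near jx ltr01).
apply: der_eps d0 _ (der_comp (i := id) (chart_change ix jx) hj) => z /hd[_ _ [jz _]].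
by rewrite /= chart_icoord.
Qed.

(** Modulo the lattice, a primitive along [p] minus a lift of [f (p t)] is locally constant. The
    lift [repr] has no continuity, but it differs from a chart value by a lattice element. *)
Lemma pullback_pathint (p : R -> X) (c : C) : continuous p -> f (p 1) = f (p 0) ->
  pathint pullback p c -> lattice tau c.
Proof.
move=> cp p01 [F [hF ->]].
pose D (t : R) := torus_pi tau (F t - repr (f (p t))).
have : D 1 = D 0.
  apply: locally_constant_segment => t t01.
  have [j [jt hj]] := pullback_local (p t).
  have FG := prim_along_any (cp t) (hF t t01) hj.
  have jn : \forall s \near t, cdom (B j) (f (p s)) := cp t _ (preimage_chart_near jt).
  apply: filterS2 FG jn => s E js; apply/torus_piP.
  have -> : F s - repr (f (p s)) - (F t - repr (f (p t))) =
    (B j (f (p s)) - repr (f (p s))) - (B j (f (p t)) - repr (f (p t))).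
    have -> : F s = F s - F t + F t by rewrite subrK.
    by rewrite E /=; ring.
  apply: latticeD; [|apply: latticeN]; apply/torus_piP;
    by rewrite torus_coord // torus_pi_surj.
by move=> /torus_piP; rewrite p01 opprB addrA subrK.
Qed.

Lemma pullback_period (g : loop A) : lattice tau (period pullback g).
Proof.
rewrite period_intS; last exact: pullback_holomorphic.
rewrite intCU mulr1z.
have := intSP (loop_simplex_fun g : singular_simplex R X 1) pullback_holomorphic.
apply: pullback_pathint; first exact: simplex_edge_continuous.
rewrite -[LHS]/(f (path_fun g (edge 1))) -[RHS]/(f (path_fun g (edge 0))).
by rewrite !path_fun_edge cl0 cl1 -(loop_periodic g 0) add0r.
Qed.

Lemma pullback_eq0_cst : connected [set: X] ->
  (forall i x, cdom (A i) x -> pullback i x = 0) -> forall x y, f x = f y.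
Proof.
move=> cX h0; apply: near_const_connected cX _ => x.
have [j [jx hj]] := pullback_local x.
apply: filterS2 (hasd0_cst h0 hj) (preimage_chart_near jx) => y E jy.
by rewrite -(torus_coord jx) -(torus_coord jy); congr torus_pi.
Qed.

End Pullback.

(** * The map to the torus given by a primitive modulo the lattice *)

Section ModLattice.
Variables (w : oneform A) (J : X -> C).
Hypothesis hw : holomorphic_oneform w.
Hypothesis hJ : forall x (G : X -> C), (\forall y \near x, hasd w G y) ->
  \forall y \near x, lattice tau (J y - J x - (G y - G x)).

Lemma mod_lattice_near x G : (\forall y \near x, hasd w G y) ->
  \forall y \near x, torus_pi tau (J y) = torus_pi tau (J x + (G y - G x)).
Proof.
by move=> /hJ; apply: filterS => y h; apply/torus_piP; rewrite opprD addrA.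
Qed.

Lemma mod_lattice_continuous : continuous (torus_pi tau \o J).
Proof.
move=> x; have [G hG] := local_primitive_form x hw.
have cG := hasd_continuous (nbhs_singleton hG).
have c : {for x, continuous (torus_pi tau \o (fun y => J x + (G y - G x)))}.
  apply: continuous_comp; last exact: torus_pi_continuous.
  by apply: cvgD; [exact: cvg_cst|apply: cvgB => //; exact: cvg_cst].
move=> U; have -> : (torus_pi tau \o J) x =
    (torus_pi tau \o (fun y => J x + (G y - G x))) x.
  by rewrite /= subrr addr0.
move=> /c; apply: filterS2 (mod_lattice_near hG) => y /= E; rewrite /= E; exact.
Qed.

(** The right-hand side stays in the disc of the chart for [y] near [x] and projects to the right
    point; lifts in that disc are unique. *)
Lemma mod_lattice_lift x (G : X -> C) j : (\forall y \near x, hasd w G y) ->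
  cdom (B j) (torus_pi tau (J x)) ->
  \forall y \near x, B j (torus_pi tau (J y)) = G y - G x + B j (torus_pi tau (J x)).
Proof.
move=> hG jx; have cG := hasd_continuous (nbhs_singleton hG).
set l := B j (torus_pi tau (J x)).
have [ld lE] : torus_disc tau j l /\ torus_pi tau l = torus_pi tau (J x).
  exact: torus_liftP jx.
have cH : {for x, continuous (fun y => G y - G x + l)}.
  by apply: cvgD; [apply: cvgB => //; exact: cvg_cst|exact: cvg_cst].
have : nbhs x [set y | torus_disc tau j (G y - G x + l)].
  apply: (cH (torus_disc tau j)); apply: open_nbhs_nbhs.
  by split; [exact: torus_disc_open|rewrite /= subrr add0r].
apply: filterS2 (mod_lattice_near hG) => y E dy.
rewrite E -[RHS](torus_liftK tau_gt0 dy); congr (torus_lift j _).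
apply/torus_piP.
have -> : J x + (G y - G x) - (G y - G x + l) = J x - l by ring.
by apply/torus_piP.
Qed.

Lemma mod_lattice_holomorphic : holomorphic_map A B (torus_pi tau \o J).
Proof.
split; first exact: mod_lattice_continuous.
move=> i j _ [x [ix jx] <-]; have [G hG] := local_primitive_form x hw.
have [d d0 hd] := chart_ball ix (mod_lattice_lift hG jx).
have h := nbhs_singleton hG i ix.
have h2 := derD h (der_cst id (B j (torus_pi tau (J x)) - G x) (A i x)).
have : cder (B j \o (torus_pi tau \o J) \o icoord (A i)) (A i x) (w i x + 0).
  apply: der_eps d0 _ h2 => z /hd[_ _ /= ->]; ring.
by move=> /cder_derivable[].
Qed.

(** If the map is constant, a local primitive has increments in the lattice; being continuous, it is
    locally constant. *)
Lemma mod_lattice_cst : (forall x y, torus_pi tau (J x) = torus_pi tau (J y)) ->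
  forall i x, cdom (A i) x -> w i x = 0.
Proof.
move=> cst i x ix; have [G hG] := local_primitive_form x hw.
have cG := hasd_continuous (nbhs_singleton hG).
have lG : \forall y \near x, lattice tau (G y - G x).
  apply: filterS (mod_lattice_near hG) => y; rewrite (cst y x) => /torus_piP.
  by rewrite opprD addrA subrr sub0r => /latticeN; rewrite opprK.
have cg : {for x, continuous (fun y => G y - G x)}.
  by apply: cvgB => //; exact: cvg_cst.
have [d d0 hd] := chart_ball ix (lattice_near_cst cg lG).
have h := nbhs_singleton hG i ix.
apply: cder_uniq h _; apply: der_eps d0 _ (der_cst id (G x) (A i x)) => z /hd[_ _].
by rewrite subrr => /eqP; rewrite subr_eq0 => /eqP.
Qed.

End ModLattice.
End TorusMaps.

(** * The theorem *)

Section RationalComplex.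
Variable R : realType.
Notation C := (Cplx R).

Lemma Im_ratr (q : rat) : Im (ratr q : C) = 0.
Proof. by rewrite -(fmorph_rat (real_complex R)). Qed.

Lemma Im_intr (n : int) : Im (n%:~R : C) = 0.
Proof. by rewrite -(rmorph_int (real_complex R)). Qed.

Lemma conj_not_rational (c : C) : (forall q : rat, c <> ratr q) ->
  forall q : rat, c^* <> ratr q.
Proof.
by move=> hc q E; apply: (hc q); rewrite -[c]conjCK E fmorph_rat.
Qed.

Lemma irrational_mul_int (c : C) (k l : int) : (forall q : rat, c <> ratr q) ->
  l%:~R = c * k%:~R -> k = 0.
Proof.
move=> hc E; apply/eqP; apply: contrapT => /negP k0; apply: (hc (l%:~R / k%:~R)).
by rewrite fmorph_div !rmorph_int /= E mulfK // intr_eq0.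
Qed.

Lemma Im_lattice (tau : C) (p q : int) : Im (p%:~R + q%:~R * tau) = q%:~R * Im tau.
Proof.
rewrite cImD cImM !Im_intr mul0r addr0 add0r; congr (_ * _).
by rewrite -(rmorph_int (real_complex R)).
Qed.

End RationalComplex.

Lemma lattice_subgroup (R : realType) (tau : Cplx R) : subgroup (lattice tau).
Proof.
by split=> [|u v hu hv]; [exact: lattice0|exact: latticeD hu (latticeN hv)].
Qed.

Lemma real_subgroup (R : realType) : subgroup [set z : Cplx R | Im z = 0].
Proof. by split=> //= u v hu hv; rewrite cImB hu hv subrr. Qed.

Section Special.
Variables (R : realType) (S : compact_riemann_surface R) (h : nat).
Variables (a b : 'I_h -> loop (atlas S)) (w : 'I_h -> oneform (atlas S)).
Hypothesis ab_symplectic : symplectic_basis a b.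
Hypothesis w_basis : oneform_basis w.
Hypothesis w_normalized : forall j k, period (w k) (a j) = (j == k)%:R.
Notation C := (Cplx R).
Notation Omega := (period_matrix w b).

Lemma alpha_period (e : oneform (atlas S)) (v : 'I_h -> C) j :
  holomorphic_oneform e ->
  (forall i x, cdom (atlas S i) x -> e i x = \sum_k v k * w k i x) ->
  period e (a j) = v j.
Proof.
move=> he ev; rewrite (period_sum _ he w_basis.1 ev).
rewrite (bigD1 j) //= w_normalized eqxx mulr1 big1 ?addr0 // => k kj.
by rewrite w_normalized eq_sym (negbTE kj) mulr0.
Qed.

Lemma beta_period (e : oneform (atlas S)) (v : 'I_h -> C) j :
  holomorphic_oneform e ->
  (forall i x, cdom (atlas S i) x -> e i x = \sum_k v k * w k i x) ->
  period e (b j) = \sum_k Omega j k * v k.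
Proof.
move=> he ev; rewrite (period_sum _ he w_basis.1 ev).
by apply: eq_bigr => k _; rewrite mxE mulrC.
Qed.

Lemma real_periods_form_eq0 (e : oneform (atlas S)) : holomorphic_oneform e ->
  (forall j, Im (period e (a j)) = 0) -> (forall j, Im (period e (b j)) = 0) ->
  forall i x, cdom (atlas S i) x -> e i x = 0.
Proof.
move=> he ha hb; apply: real_periods_eq0 => //.
- exact: points_neq0.
- exact: points_compact.
- exact: points_connected.
exact: (symplectic_cycle_intC ab_symplectic he (real_subgroup R) ha hb).
Qed.

Lemma torus_cover_special (tau : C) (tau_gt0 : 0 < Im tau) (f : S -> torus tau) x y :
  holomorphic_map (atlas S) (torus_atlas tau_gt0) f -> f x <> f y ->
  exists n m n' m' : 'rV[int]_h, (n, m) <> (0, 0) /\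
    forall j, (m' ord0 j)%:~R - \sum_k Omega j k * (n' ord0 k)%:~R =
      - tau * ((m ord0 j)%:~R - \sum_k Omega j k * (n ord0 k)%:~R).
Proof.
move=> hf fxy; have he := pullback_holomorphic hf.
have [v [ev _]] := w_basis.2 _ he.
have Ea j := alpha_period j he ev; have Eb j := beta_period j he ev.
have [p hp] := choice (fun j => pullback_period hf (a j)).
have [q hq] := choice hp.
have [r hr] := choice (fun j => pullback_period hf (b j)).
have [s hs] := choice hr.
(* The alpha periods are p + q tau, the beta periods r + s tau, and the latter are Omega times the
   former. Separating the multiples of tau gives r - Omega p = - tau (s - Omega q). *)
exists (\row_j q j), (\row_j s j), (\row_j p j), (\row_j r j); split.
  case=> /rowP q0 /rowP s0; apply: fxy; apply: pullback_eq0_cst hf _ _ _ _.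
    exact: points_connected.
  apply: real_periods_form_eq0 => // j.
    by rewrite hq Im_lattice; have := q0 j; rewrite !mxE => ->; rewrite mul0r.
  by rewrite hs Im_lattice; have := s0 j; rewrite !mxE => ->; rewrite mul0r.
move=> j; rewrite !mxE.
have /eqP := Eb j; rewrite hs.
under eq_bigr do rewrite -Ea hq mulrDr mulrA.
rewrite big_split /= -mulr_suml => /eqP E.
under eq_bigr do rewrite mxE; under [in RHS]eq_bigr do rewrite mxE.
move: E; move: (\sum_k _) (\sum_k _) => P Q E.
have -> : (r j)%:~R = Q + P * tau - (s j)%:~R * tau by rewrite -E addrK.
ring.
Qed.

Lemma special_torus_cover (n m n' m' : 'rV[int]_h) (c : C) :
  (n, m) <> (0, 0) -> (forall q : rat, c <> ratr q) ->
  (forall j, (m' ord0 j)%:~R - \sum_k Omega j k * (n' ord0 k)%:~R =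
      c * ((m ord0 j)%:~R - \sum_k Omega j k * (n ord0 k)%:~R)) ->
  exists (tau : C) (tau_gt0 : 0 < Im tau) (f : S -> torus tau),
    holomorphic_map (atlas S) (torus_atlas tau_gt0) f /\ exists x y, f x <> f y.
Proof.
move=> nm hc hE.
(* By normalization these coefficients are the alpha periods; [hE] turns the beta periods Omega v
   into m' - c m. Here [c] is the conjugate of the number in the theorem. *)
pose v k : C := (n' ord0 k)%:~R - c * (n ord0 k)%:~R.
pose e : oneform (atlas S) := fun i x => \sum_k v k * w k i x.
have he : holomorphic_oneform e by exact: holomorphic_sum w_basis.1.
have Ea j : period e (a j) = (n' ord0 j)%:~R - c * (n ord0 j)%:~R.
  exact: (@alpha_period e v j he (fun _ _ _ => erefl)).
have Eb j : period e (b j) = (m' ord0 j)%:~R - c * (m ord0 j)%:~R.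
  rewrite (@beta_period e v j he (fun _ _ _ => erefl)).
  have -> : \sum_k Omega j k * v k = \sum_k Omega j k * (n' ord0 k)%:~R -
      c * \sum_k Omega j k * (n ord0 k)%:~R.
    by rewrite mulr_sumr -sumrB; apply: eq_bigr => k _; rewrite /v; ring.
  have /eqP := hE j; rewrite subr_eq => /eqP ->; ring.
(* If the form vanished, then v = 0, and irrationality of [c] would give n = n' = 0. The relation
   would become m' = c m, so that m = 0 as well. *)
have enz : ~ forall i x, cdom (atlas S i) x -> e i x = 0.
  move=> e0; apply: nm.
  have z0 : @holomorphic_oneform R S (atlas S) (fun _ _ => 0).
    by split=> [i z _|i j x _ _]; [exact: derivable_cst|rewrite mul0r].
  have [u [_ uu]] := w_basis.2 _ z0.
  have u1 : u = \row_k v k.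
    apply: uu => i x ix; rewrite -[LHS](e0 i x ix) /e.
    by apply: eq_bigr => k _; rewrite mxE.
  have u2 : u = 0.
    by apply: uu => i x ix; rewrite big1 // => k _; rewrite mxE mul0r.
  have v0 k : v k = 0.
    by have /rowP/(_ k) := u1; rewrite u2 !mxE.
  have n0 k : n ord0 k = 0.
    apply: (irrational_mul_int hc (l := n' ord0 k)).
    by have /eqP := v0 k; rewrite subr_eq0 => /eqP.
  have n'0 k : n' ord0 k = 0.
    have /eqP := v0 k; rewrite /v n0 mulr0 subr0 intr_eq0 => /eqP //.
  have m0 k : m ord0 k = 0.
    apply: (irrational_mul_int hc (l := m' ord0 k)).
    have := hE k; rewrite !big1 ?subr0 // => l _; by rewrite ?n0 ?n'0 mulr0.
  by congr pair; apply/rowP => k; rewrite mxE.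
have Imc : Im c != 0.
  apply/eqP => c0; apply: enz; apply: real_periods_form_eq0 => // j;
    by rewrite ?Ea ?Eb cImB cImM !Im_intr c0 mulr0 mul0r addr0 subrr.
(* [c] and [- c] generate the same lattice together with 1; the sign is chosen to make the imaginary
   part positive. *)
have [tau [tau_gt0 htau]] : exists tau : C, 0 < Im tau /\
    forall k l : int, lattice tau (k%:~R - c * l%:~R).
  have [cp|cn|cz] := ltgtP (Im c) 0; last by rewrite cz eqxx in Imc.
    exists (- c); split; first by rewrite raddfN /= oppr_gt0.
    by move=> k l; exists k, l; rewrite mulrN mulrC.
  exists c; split => // k l; exists k, (- l).
  by rewrite rmorphN /= mulNr mulrC.
exists tau, tau_gt0.
have [J hJ] : exists J : S -> C, forall x (G : S -> C), (\forall y \near x, hasd e G y) ->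
    \forall y \near x, lattice tau (J y - J x - (G y - G x)).
  apply: primitive_mod; first exact: points_connected.
  apply: (symplectic_cycle_intC ab_symplectic he (lattice_subgroup tau)) => j;
    by rewrite ?Ea ?Eb; exact: htau.
exists (torus_pi tau \o J); split; first exact: (mod_lattice_holomorphic tau_gt0 he hJ).
apply: contrapT => cst; apply: enz; apply: (mod_lattice_cst tau_gt0 he hJ) => x y.
by apply: contrapT => xy; apply: cst; exists x, y.
Qed.

End Special.

Theorem theorem3 (R : realType) (S : compact_riemann_surface R) (h : nat)
    (h_ge1 : (1 <= h)%N) (genusS : has_genus R S h)
    (a b : 'I_h -> loop (atlas S)) (ab_symplectic : symplectic_basis a b)
    (w : 'I_h -> oneform (atlas S)) (w_basis : oneform_basis w)
    (w_normalized : forall j k, period (w k) (a j) = (j == k)%:R)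
    (Omega : 'M[Cplx R]_h) (OmegaE : Omega = period_matrix w b) :
  (exists (n m n' m' : 'rV[int]_h) (c : Cplx R),
    [/\ (n, m) <> (0, 0),
        forall q : rat, c <> ratr q &
        forall j : 'I_h,
          (m' ord0 j)%:~R - \sum_k Omega j k * (n' ord0 k)%:~R =
          c^* * ((m ord0 j)%:~R - \sum_k Omega j k * (n ord0 k)%:~R)]) <->
  (exists (tau : Cplx R) (tau_gt0 : 0 < complex.Im tau) (f : S -> torus tau),
    holomorphic_map (atlas S) (torus_atlas tau_gt0) f /\
    exists x y, f x <> f y).
Proof.
rewrite OmegaE; split.
  move=> [n [m [n' [m' [c [nm hc hE]]]]]].
  exact: (special_torus_cover ab_symplectic w_basis w_normalized nm
    (conj_not_rational hc) hE).
move=> [tau [tau_gt0 [f [hf [x [y fxy]]]]]].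
have [n [m [n' [m' [nm hE]]]]] :=
  torus_cover_special ab_symplectic w_basis w_normalized hf fxy.
(* The conjugate of this number is - tau, the factor in [hE]. Its imaginary part is that of tau,
   hence positive, so it is not rational. *)
exists n, m, n', m', (- tau^*); split => //.
  move=> q /(congr1 (@complex.Im R)); rewrite Im_ratr raddfN /= cIm_conj opprK => E.
  by have := tau_gt0; rewrite E ltxx.
by move=> j; rewrite rmorphN /= conjCK hE.
Qed.
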